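(* Let $X$ be a Banach space whose dual is locally uniformly convex, and let $U\subseteq X$ be open and convex. For every convex function $f:U\to\mathbb{R}$ which is bounded on every bounded subset $B$ of $U$ with $\mathrm{dist}(B,\partial U)>0$, and for every $\varepsilon>0$, there exists a $C^1$ convex function $g:U\to\mathbb{R}$ such that $f-\varepsilon\leq g\leq f$ on $U$. Moreover $g$ can be taken so as to preserve the set of minimizers and the local Lipschitz constants of $f$. And if $f$ is strictly convex, then $g$ can be taken to be strictly convex.
   Context: If $U=X$, one sets $\mathrm{dist}(B,\partial U)=\infty$ for every bounded set $B$. ''Preserves the set of minimizers'' means that $g$ and $f$ have the same set of points at which they attain their minimum. ''Preserves the local Lipschitz constants'' means $\mathrm{Lip}(g|_{B})\leq\mathrm{Lip}(f|_{(1+\varepsilon)B})$ for every ball $B\subset U$, where for $B$ of center $x$ and radius $r$, $(1+\varepsilon)B$ is the ball of center $x$ and radius $(1+\varepsilon)r$, and $f|_{(1+\varepsilon)B}$ is the restriction of $f$ to $(1+\varepsilon)B\cap U$. *)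

(* Defs.v *)
From HB Require Import structures.
From mathcomp Require Import all_boot all_order all_algebra.
From mathcomp Require Import interval_inference.
From mathcomp Require Import boolp classical_sets functions reals ereal.
From mathcomp Require Import topology normedtype derive convex.

Set Implicit Arguments.
Unset Strict Implicit.
Unset Printing Implicit Defensive.

Import Order.TTheory GRing.Theory Num.Theory.
Import numFieldNormedType.Exports.

Local Open Scope classical_set_scope.
Local Open Scope ring_scope.
Local Open Scope convex_scope.

(* A function U -> R is represented by a total function on X, and every
   predicate below depends only on its values on U (for C1_on, because U is
   meant to be open). *)

Section defs.
Context {R : realType} {X : normedModType R}.

(* The supremum is finite when phi is linear and continuous. *)
Definition dual_norm (phi : X -> R) : R :=
  sup [set `|phi x| | x in [set x : X | `|x| <= 1]].

Definition frontier (U : set X) : set X := closure U `\` U°.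

(* The infimum of the empty set is +oo, so set_dist B (frontier setT) = +oo. *)
Definition set_dist (A B : set X) : \bar R :=
  ereal_inf [set edist_inf B a | a in A].

Definition strictly_convex_function (U : set (convex_lmodType X))
    (f : convex_lmodType X -> R^o) : Prop :=
  forall t : {i01 R}, 0 < t%:num -> t%:num < 1 ->
  forall x y : convex_lmodType X, x \in U -> y \in U -> x != y ->
    (f (x <| t |> y) < f x <| t |> f y)%R.

Definition C1_on (U : set X) (f : X -> R) : Prop :=
  (forall x, U x -> differentiable f x) /\
  (forall x, U x -> dual_norm ('d f y \- 'd f x) @[y --> x] --> (0 : R)).

Definition minimizers (U : set X) (f : X -> R) : set X :=
  [set x | U x /\ forall y, U y -> f x <= f y].

(* The smallest Lipschitz constant of f on A, +oo if f is not Lipschitz there;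
   0 <= k only matters when A has at most one point. *)
Definition Lip (A : set X) (f : X -> R) : \bar R :=
  ereal_inf [set k%:E | k in [set k : R | 0 <= k /\ k.-lipschitz_A f]].

(* Stated for open balls and for closed balls. *)
Definition preserves_local_Lip (eps : R) (U : set X) (f g : X -> R) : Prop :=
  forall (x : X) (r : R), 0 < r ->
    (ball x r `<=` U ->
      (Lip (ball x r) g <= Lip (ball x ((1 + eps) * r) `&` U) f)%E) /\
    (closed_ball x r `<=` U ->
      (Lip (closed_ball x r) g
        <= Lip (closed_ball x ((1 + eps) * r) `&` U) f)%E).

End defs.

Definition dual_locally_uniformly_convex (R : realType) (X : normedModType R)
    : Prop :=
  forall phi : {linear X -> R^o}, continuous phi -> dual_norm phi = 1 ->
  forall e : R, 0 < e -> exists2 d : R, 0 < d &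
    forall psi : {linear X -> R^o}, continuous psi -> dual_norm psi = 1 ->
      e <= dual_norm (phi \- psi) -> dual_norm (phi \+ psi) / 2 <= 1 - d.

(* Main.v *)
(**
Boundedness makes f locally Lipschitz, hence U is the union of the interiors of
the sets A_n of points x with f x - f z <= n |x - z| for all z in U. The infimal
convolution f_l x = inf_y (f y + l |x - y|^2) is convex, below f, at least
f - n^2 / 4l on A_n, keeps the infimum of f, and inherits at each x the slope
bounds of f at x. It is differentiable on U: at x in U it has a subgradient p,
near-minimizers y of f_l x have x - y almost norming p, and dual local uniform
convexity makes the derivatives of the norm near x - y close to p / |p|.
To be uniformly close to f on U, take smooth maxima of the f_l lowered by
amounts increasing to eps, with l increasing so quickly that the n-th maximum
alters nothing on A_n. Averaging with weights 2^-(k+1) the approximations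
obtained for eps / (k+1) recovers strict convexity.
*)

Require Import Defs.
From HB Require Import structures.
From mathcomp Require Import all_boot all_order all_algebra.
From mathcomp Require Import interval_inference.
From mathcomp Require Import boolp classical_sets functions reals ereal.
From mathcomp Require Import topology normedtype sequences landau derive convex.
From mathcomp Require Import lra ring.

Import Order.TTheory GRing.Theory Num.Theory.
Import numFieldNormedType.Exports.

Local Open Scope classical_set_scope.
Local Open Scope ring_scope.

Set Implicit Arguments.
Unset Strict Implicit.
Unset Printing Implicit Defensive.

(** * The Hahn-Banach theorem through minimal sublinear functionals *)

Section HahnBanach.
Context {R : realType} {X : lmodType R}.
Implicit Types (p q : X -> R) (u v : X) (t : R).

(** The proof is carried by the one-sided slope bound f x - f z <= k |x - z|, attached to a point x
    but valid for all z in U. Convexity makes it local: growth of at most k r on one small sphere of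
    radius r about x inside U implies it. Smooth maxima and averages inherit it too, at the same x
    with the same k. Used at both of two points it is a Lipschitz estimate, which is how local
    Lipschitz constants survive; the factor 1 + eps makes the points of a ball interior to the
    larger ball. Infima need not be attained, neither in the infimal convolution nor in the norm of
    p. Hence only near-minimizers and approximate subgradients are available, and the smoothness
    estimate for the squared norm must hold with a tolerance and a radius that do not depend on the
    near-minimizer. Dual local uniform convexity gives exactly this uniformity. One value of l is
    not enough, because the error n^2 / 4l depends on the slope and f may have unbounded slopes on
    U. Differentiability is tracked by an upper bound on symmetric second differences, which passes
    through maxima and averages without reference to derivatives. *)

Definition sublinear p :=
  (forall u v, p (u + v) <= p u + p v) /\
  (forall t u, 0 <= t -> p (t *: u) = t * p u).

Lemma sublinearP p : (forall u v, p (u + v) <= p u + p v) ->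
  (forall t u, 0 <= t -> p (t *: u) <= t * p u) -> sublinear p.
Proof.
move=> pD pZ; split=> // t u t0; apply/eqP; rewrite eq_le pZ//=.
have [->|tn0] := eqVneq t 0.
  have := pZ 0 u (lexx _); have := pD (0 *: u) (0 *: u).
  by rewrite !scale0r addr0 mul0r => h1 h2; lra.
have tp : 0 < t by rewrite lt_neqAle eq_sym tn0.
have := pZ t^-1 (t *: u); rewrite invr_ge0 => /(_ t0).
by rewrite scalerA mulVf// scale1r mulrC ler_pdivlMr// mulrC.
Qed.

Lemma sublinear0 p : sublinear p -> p 0 = 0.
Proof. by case=> _ /(_ 0 0 (lexx _)); rewrite scale0r mul0r. Qed.

Lemma sublinear_geN p v : sublinear p -> - p (- v) <= p v.
Proof.
by move=> sp; have := sp.1 v (- v); rewrite subrr sublinear0// => ?; lra.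
Qed.

(** Lower bounds of chains, for Zorn's lemma. Subadditivity of the infimum uses the chain: of two
    functionals nearly optimal at u and at v, the smaller one is nearly optimal at both. *)
Lemma inf_sublinear (A : set (X -> R)) q : A !=set0 ->
  (forall p, A p -> sublinear p) -> (forall p, A p -> forall v, p v <= q v) ->
  (forall p1 p2, A p1 -> A p2 ->
    (forall v, p1 v <= p2 v) \/ (forall v, p2 v <= p1 v)) ->
  exists2 p0, sublinear p0 & forall p, A p -> forall v, p0 v <= p v.
Proof.
move=> [a Aa] Asub Aq Atot; pose E v := [set p v | p in A].
have lbE v : lbound (E v) (- q (- v)).
  move=> _ [p Ap <-]; apply: le_trans (sublinear_geN v (Asub _ Ap)).
  by rewrite lerN2; exact: Aq.
have hE v : has_inf (E v) by split; [exists (a v), a | exists (- q (- v))].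
have infE p v : A p -> inf (E v) <= p v.
  by move=> Ap; apply: ge_inf; [exact: (hE v).2 | exists p].
exists (fun v => inf (E v)); last by move=> p Ap v; exact: infE.
apply: sublinearP => [u v|t u t0].
  apply/ler_addgt0Pr => e e0.
  have e2 : 0 < e / 2 by lra.
  have [_ [p1 A1 <-] h1] := inf_adherent e2 (hE u).
  have [_ [p2 A2 <-] h2] := inf_adherent e2 (hE v).
  have [le12|le21] := Atot _ _ A1 A2.
    have := infE _ (u + v) A1; have := (Asub _ A1).1 u v; have := le12 v; lra.
  have := infE _ (u + v) A2; have := (Asub _ A2).1 u v; have := le21 u; lra.
have [->|tn0] := eqVneq t 0.
  rewrite scale0r mul0r; have := infE _ 0 Aa.
  by rewrite sublinear0//; exact: Asub.
have tp : 0 < t by rewrite lt_neqAle eq_sym tn0.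
rewrite mulrC -ler_pdivrMr//; apply: lb_le_inf; first exact: (hE u).1.
move=> _ [p Ap <-]; rewrite ler_pdivrMr// mulrC -(Asub _ Ap).2//.
exact: infE.
Qed.

Lemma minimal_sublinear q : sublinear q ->
  exists p, [/\ sublinear p, forall v, p v <= q v &
    forall p', sublinear p' -> (forall v, p' v <= p v) -> p' = p].
Proof.
move=> sq.
pose T := {p | sublinear p /\ forall v, p v <= q v}.
(* The order is reversed, so that a maximal element is a minimal functional. *)
pose le (a b : T) := `[< forall v, sval b v <= sval a v >].
have [| |A Atot|[p [sp pq]] pmin] :=
  @ZL_preorder T (exist _ q (conj sq (fun=> lexx _))) le.
- by move=> a; apply/asboolP.
- move=> a b c /asboolP ab /asboolP bc; apply/asboolP => v.
  exact: le_trans (bc v) (ab v).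
- have [->|/set0P[a Aa]] := eqVneq A set0.
    by exists (exist _ q (conj sq (fun=> lexx _))).
  have [|_ [b _ <-]|_ [b _ <-] v|_ _ [b Ab <-] [c Ac <-]|p sp ple] :=
    @inf_sublinear [set sval b | b in A] q.
  + by exists (sval a), a.
  + exact: (svalP b).1.
  + exact: (svalP b).2.
  + by have [/asboolP h|/asboolP h] := Atot _ _ Ab Ac; [right|left].
  have pq v : p v <= q v.
    by apply: le_trans ((svalP a).2 v); apply: ple; exists a.
  exists (exist _ p (conj sp pq)) => b Ab; apply/asboolP => v /=.
  by apply: ple; exists b.
exists p; split=> // p' sp' le_p'p.
have p'q v : p' v <= q v by exact: le_trans (le_p'p v) (pq v).
have /asboolP/= le_pp' : le (exist _ p' (conj sp' p'q)) (exist _ p (conj sp pq)).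
  by apply: pmin; apply/asboolP.
by apply/funext => v; apply/eqP; rewrite eq_le le_p'p le_pp'.
Qed.

(* Minimality of p is tested against v |-> inf_(t >= 0) p (v + t u) - t p u,
   which is sublinear; the value t = 1 makes p superadditive. *)
Lemma hahn_banach q : sublinear q ->
  exists p : {linear X -> R^o}, forall v, p v <= q v.
Proof.
move=> /minimal_sublinear[p [sp pq pmin]].
have superadd u v : p u + p v <= p (v + u).
  pose E w := [set p (w + t *: u) - t * p u | t in [set t : R | 0 <= t]].
  have lbE w : lbound (E w) (- p (- w)).
    move=> _ [t t0 <-]; rewrite -(sp.2 t u t0).
    have := sp.1 (w + t *: u) (- w); rewrite addrAC subrr add0r; lra.
  have hE w : has_inf (E w).
    by split; [exists (p (w + 0 *: u) - 0 * p u), 0 => /= | exists (- p (- w))].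
  have infE w t : 0 <= t -> inf (E w) <= p (w + t *: u) - t * p u.
    by move=> t0; apply: ge_inf; [exact: (hE w).2 | exists t].
  have -> : p v = inf (E v); last first.
    by have := infE v _ ler01; rewrite scale1r mul1r; lra.
  have <- // : (fun w => inf (E w)) = p.
  apply: pmin => [|w]; last first.
    by have := infE w 0 (lexx _); rewrite scale0r mul0r addr0 subr0.
  apply: sublinearP => [w1 w2|t w t0].
    apply/ler_addgt0Pr => e e0.
    have e2 : 0 < e / 2 by lra.
    have [_ [t1 /= t10 <-] h1] := inf_adherent e2 (hE w1).
    have [_ [t2 /= t20 <-] h2] := inf_adherent e2 (hE w2).
    have := infE (w1 + w2) (t1 + t2) (addr_ge0 t10 t20).
    have := sp.1 (w1 + t1 *: u) (w2 + t2 *: u).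
    rewrite addrACA -scalerDl mulrDl; lra.
  have [->|tn0] := eqVneq t 0.
    have := infE 0 0 (lexx _); rewrite !scale0r addr0 !mul0r subr0.
    by rewrite sublinear0.
  have tp : 0 < t by rewrite lt_neqAle eq_sym tn0.
  rewrite mulrC -ler_pdivrMr//; apply: lb_le_inf; first exact: (hE w).1.
  move=> _ [s /= s0 <-]; rewrite ler_pdivrMr// mulrC.
  rewrite mulrBr -(sp.2 t (w + s *: u))// scalerDr scalerA mulrA; apply: infE.
  exact: mulr_ge0.
have pD u v : p (u + v) = p u + p v.
  by apply/eqP; rewrite eq_le sp.1/= [in leRHS]addrC superadd.
have pN u : p (- u) = - p u.
  by have := pD u (- u); rewrite subrr sublinear0// => ?; lra.
have lp : linear (p : X -> R^o).
  move=> t u v; rewrite pD; congr (_ + _); rewrite -[RHS]/(t * p u).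
  have [t0|t0] := leP 0 t; first exact: sp.2.
  rewrite -[t *: u]opprK -scaleNr pN sp.2 ?mulNr ?opprK//; lra.
pose L : {linear X -> R^o} := HB.pack (p : X -> R^o) (GRing.isLinear.Build _ _ _ _ _ lp).
by exists L.
Qed.

End HahnBanach.

(** * Subgradients with a norm bound, norming functionals, the dual norm *)

Section Subgradient.
Context {R : realType} {X : normedModType R}.
Implicit Types (U : set X) (g : X -> R) (x y z v : X) (p : {linear X -> R^o}).

Definition cset U := forall t x y, 0 <= t -> t <= 1 -> U x -> U y ->
  U (t *: x + (1 - t) *: y).

Definition cfun U g := forall t x y, 0 <= t -> t <= 1 -> U x -> U y ->
  g (t *: x + (1 - t) *: y) <= t * g x + (1 - t) * g y.

(** For [g] convex on a convex U, x in U and 0 <= k, this holds exactly when [g] has at x a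
    subgradient of norm at most k. *)
Definition slope_le U g k x := forall z, U z -> g x - g z <= k * `|x - z|.

(** The infimum of [E v] is the largest sublinear function that is below k |.| and, for every z in
    U, at most g z - g x at z - x. The slope bound keeps it finite, and a linear form below it has
    both properties: take t = 0 for the first and t = 1, v = z - x for the second. *)
Lemma subgradient U g k x : cset U -> cfun U g -> U x -> 0 <= k ->
  slope_le U g k x ->
  exists p, (forall v, `|p v| <= k * `|v|) /\
    forall z, U z -> g x + p (z - x) <= g z.
Proof.
move=> cU cg Ux k0 gk.
pose E v := [set r | exists t z, [/\ 0 <= t, U z &
  r = t * (g z - g x) + k * `|v - t *: (z - x)|]].
have lbE v : lbound (E v) (- (k * `|v|)).
  move=> _ [t [z [t0 Uz ->]]]; have := gk z Uz => h.
  have : t * (g x - g z) <= t * (k * `|x - z|) by exact: ler_wpM2l.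
  have -> : t * (k * `|x - z|) = k * `|t *: (z - x)|.
    by rewrite normrZ ger0_norm// distrC mulrCA.
  have : k * `|t *: (z - x)| <= k * (`|v| + `|v - t *: (z - x)|).
    apply: ler_wpM2l => //; have := ler_normB v (v - t *: (z - x)).
    by rewrite subKr.
  rewrite mulrDr !mulrBr; lra.
have hE v : has_inf (E v).
  split; last by exists (- (k * `|v|)).
  by exists (0 * (g x - g x) + k * `|v - 0 *: (x - x)|), 0, x.
have infE v t z : 0 <= t -> U z ->
    inf (E v) <= t * (g z - g x) + k * `|v - t *: (z - x)|.
  by move=> t0 Uz; apply: ge_inf; [exact: (hE v).2 | exists t, z].
have sub : sublinear (fun v => inf (E v)).
  apply: sublinearP => [u v|s v s0].
    apply/ler_addgt0Pr => e e0.
    have e2 : 0 < e / 2 by lra.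
    have [_ [t1 [z1 [t10 Uz1 ->]]] h1] := inf_adherent e2 (hE u).
    have [_ [t2 [z2 [t20 Uz2 ->]]] h2] := inf_adherent e2 (hE v).
    have [t12|t12] := eqVneq (t1 + t2) 0.
      have t1E : t1 = 0 by lra.
      have t2E : t2 = 0 by lra.
      have := infE (u + v) 0 x (lexx _) Ux; move: h1 h2.
      rewrite t1E t2E !scale0r !mul0r !subr0 !add0r.
      have : k * `|u + v| <= k * (`|u| + `|v|).
        by apply: ler_wpM2l => //; exact: ler_normD.
      rewrite mulrDr; lra.
    have t12p : 0 < t1 + t2 by rewrite lt_neqAle eq_sym t12 addr_ge0.
    pose s := t1 / (t1 + t2).
    have s0 : 0 <= s by rewrite divr_ge0// ltW.
    have s1 : s <= 1 by rewrite ler_pdivrMr// mul1r lerDl.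
    have sE : (t1 + t2) * s = t1 by rewrite mulrC divfK.
    have s'E : (t1 + t2) * (1 - s) = t2 by rewrite mulrBr sE; lra.
    have := infE (u + v) (t1 + t2) _ (addr_ge0 t10 t20) (cU s z1 z2 s0 s1 Uz1 Uz2).
    have -> : (t1 + t2) *: (s *: z1 + (1 - s) *: z2 - x) =
        t1 *: (z1 - x) + t2 *: (z2 - x).
      rewrite scalerBr scalerDr !scalerA sE s'E scalerDl !scalerBr.
      by rewrite opprD addrACA.
    have : (t1 + t2) * (g (s *: z1 + (1 - s) *: z2) - g x) <=
        t1 * (g z1 - g x) + t2 * (g z2 - g x).
      have -> : t1 * (g z1 - g x) + t2 * (g z2 - g x) =
          (t1 + t2) * ((s * g z1 + (1 - s) * g z2) - g x).
        rewrite -[in LHS]s'E -[X in X * (g z1 - _)]sE; ring.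
      by apply: ler_wpM2l; [exact: ltW | rewrite lerB// cg].
    have : k * `|u + v - (t1 *: (z1 - x) + t2 *: (z2 - x))| <=
        k * (`|u - t1 *: (z1 - x)| + `|v - t2 *: (z2 - x)|).
      apply: ler_wpM2l => //; rewrite opprD addrACA; exact: ler_normD.
    rewrite mulrDr; lra.
  have [->|sn0] := eqVneq s 0.
    rewrite scale0r mul0r; have := infE 0 0 x (lexx _) Ux.
    by rewrite scale0r subr0 mul0r add0r normr0 mulr0.
  have sp : 0 < s by rewrite lt_neqAle eq_sym sn0.
  rewrite mulrC -ler_pdivrMr//; apply: lb_le_inf; first exact: (hE v).1.
  move=> _ [t [z [t0 Uz ->]]]; rewrite ler_pdivrMr//.
  have := infE (s *: v) (s * t) z (mulr_ge0 s0 t0) Uz.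
  rewrite -scalerA -scalerBr normrZ (ger0_norm s0).
  by rewrite mulrDl -!mulrA [s * (t * _)]mulrCA [s * `|_|]mulrC [s * (g z - g x)]mulrC.
have [p pE] := hahn_banach sub.
have pk v : p v <= k * `|v|.
  apply: le_trans (pE v) _; have := infE v 0 x (lexx _) Ux.
  by rewrite scale0r subr0 mul0r add0r.
exists p; split=> [v|z Uz].
  rewrite ler_norml pk andbT lerNl.
  by have := pk (- v); rewrite normrN raddfN.
have := le_trans (pE (z - x)) (infE (z - x) 1 z ler01 Uz).
rewrite scale1r subrr normr0 mulr0 addr0 mul1r; lra.
Qed.

(** A subgradient of the norm at x, tested at 0, takes a value at least |x| at x. *)
Lemma norming x : exists p, (forall v, `|p v| <= `|v|) /\ p x = `|x|.
Proof.
have [|t y z t0 t1 _ _|||y _|p [p1 pn]] := @subgradient setT Num.norm 1 x.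
- by [].
- have t1' : 0 <= 1 - t by lra.
  rewrite -[X in X * `|y|]ger0_norm// -[X in _ + X * `|z|]ger0_norm//.
  by rewrite -!normrZ; exact: ler_normD.
- by [].
- exact: ler01.
- by rewrite mul1r lerB_dist.
have {}p1 v : `|p v| <= `|v| by have := p1 v; rewrite mul1r.
exists p; split=> //; apply/eqP; rewrite eq_le.
rewrite (le_trans (ler_norm _) (p1 _))/=.
by have := pn 0 I; rewrite normr0 sub0r raddfN; rewrite subr_le0.
Qed.

Lemma dual_norm_le (phi : X -> R) k : phi 0 = 0 ->
  (forall v, `|v| <= 1 -> `|phi v| <= k) -> dual_norm phi <= k.
Proof.
move=> phi0 phik; apply: sup_le_ub.
  by exists `|phi 0|, 0 => //=; rewrite normr0.
by move=> _ [v v1 <-]; exact: phik.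
Qed.

Lemma dual_norm_ge0 p : 0 <= dual_norm p.
Proof.
rewrite /dual_norm; set A := (X in sup X).
(* For an unbounded form the supremum does not exist and [sup] is 0 by default. *)
have [hA|hA] := pselect (has_sup A); last by rewrite sup_out.
apply: le_trans (normr_ge0 (p 0)) _; apply: (sup_upper_bound hA).
by exists 0; rewrite //= normr0.
Qed.

Lemma le_dual_norm (phi : X -> R) k v :
  (forall t u, phi (t *: u) = t * phi u) ->
  (forall u, `|phi u| <= k * `|u|) -> `|phi v| <= dual_norm phi * `|v|.
Proof.
move=> phiZ phik.
have [->|v0] := eqVneq v 0.
  by rewrite normr0 mulr0 -(scale0r 0) phiZ mul0r normr0.
have vp : 0 < `|v| by rewrite normr_gt0.
rewrite -ler_pdivrMr//.
have -> : `|phi v| / `|v| = `|phi (`|v|^-1 *: v)|.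
  by rewrite phiZ normrM normfV normr_id mulrC.
apply: sup_upper_bound; last first.
  by exists (`|v|^-1 *: v) => //=; rewrite normrZ normfV normr_id mulVf ?gt_eqF.
split; first by exists `|phi 0|, 0 => //=; rewrite normr0.
exists `|k| => _ [u /= u1 <-]; apply: le_trans (phik u) _.
apply: le_trans (_ : `|k| * `|u| <= _); first by rewrite ler_wpM2r// ler_norm.
by rewrite ler_piMr.
Qed.

End Subgradient.

(** * Smoothness of the squared norm near approximate contact points *)

Section SmoothNorm.
Context {R : realType} {X : normedModType R}.
Implicit Types (p q : {linear X -> R^o}) (u v w : X).

Lemma linZ p (t : R) v : p (t *: v) = t * p v.
Proof. exact: linearZ_LR. Qed.

Lemma lin_cont p k : (forall v, `|p v| <= k * `|v|) -> continuous p.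
Proof.
move=> pk; apply: bounded_linear_continuous; apply/linear_boundedP.
exists k; split=> [|r kr v]; first exact: num_real.
by apply: le_trans (pk v) _; rewrite ler_wpM2r// ltW.
Qed.

Lemma quad_ge (l k r : R) : 0 < l -> k * r - l * r ^+ 2 <= k ^+ 2 / (4 * l).
Proof.
move=> l0; rewrite -subr_ge0.
have -> : k ^+ 2 / (4 * l) - (k * r - l * r ^+ 2) = l * (r - k / (2 * l)) ^+ 2.
  by field; rewrite gt_eqF.
by rewrite mulr_ge0 ?sqr_ge0// ltW.
Qed.

Lemma dual_norm_norming q u : u != 0 -> (forall v, `|q v| <= `|v|) ->
  q u = `|u| -> dual_norm q = 1.
Proof.
move=> u0 q1 qu; apply/eqP; rewrite eq_le; apply/andP; split.
  by apply: dual_norm_le => [|v v1]; [exact: raddf0 | exact: le_trans (q1 v) v1].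
have := @le_dual_norm _ _ q 1 u (linZ q).
rewrite qu normr_id => h; rewrite -(ler_pM2r (x := `|u|)) ?normr_gt0// mul1r.
by apply: h => v; rewrite mul1r.
Qed.

(* The hypothesis on w says that p is an [eta]-subgradient of [l |.|^2] at w.
   It forces |w| to be close to |p| / 2l and p to be almost normed by w, so that
   dual local uniform convexity puts the subgradients of the norm near w close
   to p / |p|. *)
Lemma sqr_norm_smooth p k l e : dual_locally_uniformly_convex X ->
  (forall v, `|p v| <= k * `|v|) -> 0 < l -> 0 < e ->
  exists eta, 0 < eta /\ exists2 d, 0 < d & forall w v,
    (forall w', p (w' - w) <= l * `|w'| ^+ 2 - l * `|w| ^+ 2 + eta) ->
    `|v| < d -> l * `|w + v| ^+ 2 - l * `|w| ^+ 2 <= p v + e * `|v|.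
Proof.
move=> luc pk l0 e0; pose P := dual_norm p.
have P0 : 0 <= P by exact: dual_norm_ge0.
have pP v : `|p v| <= P * `|v| by exact: le_dual_norm (linZ p) pk.
(* Young's inequality is almost an equality at [w]: s = P / 2l is the norm at which P s - l s^2
   takes its maximal value P^2 / 4l. *)
have attain w eta :
    (forall w', p (w' - w) <= l * `|w'| ^+ 2 - l * `|w| ^+ 2 + eta) ->
    P ^+ 2 / (4 * l) + l * `|w| ^+ 2 - eta <= p w.
  move=> pw; pose s := P / (2 * l).
  have [P00|Pn0] := eqVneq P 0.
    have := pw 0; rewrite sub0r raddfN normr0 P00 expr0n/= !mulr0 mul0r; lra.
  have s0 : 0 < s by rewrite divr_gt0// ?mulr_gt0// lt_neqAle eq_sym Pn0.
  have : P <= (p w - l * `|w| ^+ 2 + eta + l * s ^+ 2) / s.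
    apply: dual_norm_le => [|v v1]; first exact: raddf0.
    have pv u : `|u| <= 1 ->
        p u <= (p w - l * `|w| ^+ 2 + eta + l * s ^+ 2) / s.
      move=> u1; rewrite ler_pdivlMr// mulrC -linZ.
      have := pw (s *: u); rewrite raddfB normrZ gtr0_norm//.
      have : l * (s * `|u|) ^+ 2 <= l * s ^+ 2.
        by rewrite ler_pM2l// exprMn ler_piMr ?sqr_ge0// exprn_ile1.
      lra.
    rewrite ler_norml lerNl -raddfN !pv ?normrN//.
  rewrite ler_pdivlMr//.
  have -> : P * s = P ^+ 2 / (4 * l) + l * s ^+ 2 by rewrite /s; field; lra.
  lra.
(* Combined with p w <= P |w|, the bound of [attain] completes to a square; this is why [eta] is
   chosen as l rho^2 below. *)
have close w rho :
    0 <= rho -> P ^+ 2 / (4 * l) + l * `|w| ^+ 2 - l * rho ^+ 2 <= p w ->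
    `| `|w| - P / (2 * l)| <= rho.
  move=> rho0 pw; rewrite -(ler_pXn2r (ltn0Sn 1)) ?nnegrE// real_normK ?num_real//.
  rewrite -(ler_pM2l l0).
  have -> : l * (`|w| - P / (2 * l)) ^+ 2 =
      P ^+ 2 / (4 * l) + l * `|w| ^+ 2 - P * `|w| by field; lra.
  have := le_trans (ler_norm _) (pP w); lra.
(* [q] is a subgradient of the norm at w + v, and the factor l (|w + v| + |w|) differs from P by at
   most l (d + 2 rho). *)
have bound w v q rho d : 0 < rho -> `|v| < d -> d <= rho ->
    `| `|w| - P / (2 * l)| <= rho ->
    (forall u, `|q u| <= `|u|) -> q (w + v) = `|w + v| ->
    l * `|w + v| ^+ 2 - l * `|w| ^+ 2 <= P * q v + 3 * l * rho * `|v|.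
  move=> rho0 vd drho wP q1 qu.
  have le1 : `|w + v| - `|w| <= q v.
    have := le_trans (ler_norm _) (q1 w); move: qu; rewrite raddfD/=; lra.
  have -> : l * `|w + v| ^+ 2 - l * `|w| ^+ 2 =
    l * (`|w + v| + `|w|) * (`|w + v| - `|w|) by ring.
  apply: le_trans (_ : l * (`|w + v| + `|w|) * q v <= _).
    by apply: ler_wpM2l => //; rewrite mulr_ge0 ?addr_ge0// ltW.
  have : (l * (`|w + v| + `|w|) - P) * q v <= 3 * l * rho * `|v|.
    apply: le_trans (ler_norm _) _; rewrite normrM.
    apply: ler_pM => //.
    have -> : l * (`|w + v| + `|w|) - P =
      l * ((`|w + v| - `|w|) + 2 * (`|w| - P / (2 * l))) by field; lra.
    rewrite normrM gtr0_norm// [3 * l]mulrC -mulrA ler_pM2l//.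
    apply: le_trans (ler_normD _ _) _; rewrite normrM (ger0_norm (ler0n _ 2)).
    have := lerB_dist (w + v) w; have := ler_dist_dist (w + v) w.
    have -> : w + v - w = v by rewrite addrC addKr.
    lra.
  lra.
have [P00|Pn0] := eqVneq P 0.
  have rho0 : 0 < e / (3 * l) by rewrite divr_gt0// mulr_gt0.
  exists (l * (e / (3 * l)) ^+ 2); split; first by rewrite mulr_gt0 ?exprn_gt0.
  exists (e / (3 * l)) => // w v /attain/(close _ _ (ltW rho0)) wP vd.
  have [q [q1 qu]] := norming (w + v).
  have := bound w v q _ _ rho0 vd (lexx _) wP q1 qu.
  have -> : p v = 0.
    by apply/eqP; rewrite -normr_le0 (le_trans (pP v))// P00 mul0r.
  have -> : 3 * l * (e / (3 * l)) = e by field; lra.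
  by rewrite P00 mul0r.
have Pp : 0 < P by rewrite lt_neqAle eq_sym Pn0.
pose phi : {linear X -> R^o} := P^-1 \*: p.
have phiE v : phi v = P^-1 * p v by [].
have phi1 v : `|phi v| <= 1 * `|v|.
  rewrite phiE normrM mul1r gtr0_norm ?invr_gt0//.
  by rewrite -ler_pdivlMl ?invr_gt0// invrK.
have phin : dual_norm phi = 1.
  apply/eqP; rewrite eq_le; apply/andP; split.
    apply: dual_norm_le => [|v v1]; first exact: raddf0.
    by apply: le_trans (phi1 v) _; rewrite mul1r.
  rewrite -(ler_pM2l Pp) mulr1; apply: dual_norm_le => [|v v1].
    exact: raddf0.
  have -> : p v = P * phi v by rewrite phiE mulrA divff ?mul1r.
  rewrite normrM gtr0_norm// ler_pM2l//.
  have := @le_dual_norm _ _ phi 1 v (linZ phi) phi1.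
  by move=> /le_trans; apply; rewrite ler_piMr// dual_norm_ge0.
have e'0 : 0 < e / (2 * P) by rewrite divr_gt0// mulr_gt0.
have [del del0 lucE] := luc phi (lin_cont phi1) phin _ e'0.
(* As bounds on rho l: e / 8 brings the error 3 l rho of [bound] below e / 2, P / 8 keeps [w] and w
   + v away from 0, and del P / 8 makes the amounts by which [phi] and [q] fail to norm [w] small
   against del |w|. *)
pose rho := Num.min (e / (8 * l)) (Num.min (P / (8 * l)) (del * P / (8 * l))).
have rho0 : 0 < rho by rewrite !lt_min !divr_gt0 ?mulr_gt0.
have rho1 : rho * l <= e / 8.
  rewrite -ler_pdivlMr// (_ : e / 8 / l = e / (8 * l)); last by field; lra.
  by rewrite ge_min lexx.
have rho2 : rho * l <= P / 8.
  rewrite -ler_pdivlMr// (_ : P / 8 / l = P / (8 * l)); last by field; lra.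
  by rewrite !ge_min lexx orbT.
have rho3 : rho * l <= del * P / 8.
  rewrite -ler_pdivlMr// (_ : del * P / 8 / l = del * P / (8 * l)); last by field; lra.
  by rewrite !ge_min lexx !orbT.
exists (l * rho ^+ 2); split; first by rewrite mulr_gt0 ?exprn_gt0.
exists rho => // w v /attain pw vd.
have wP := close _ _ (ltW rho0) pw.
have [q [q1 qu]] := norming (w + v).
have := bound w v q _ _ rho0 vd (lexx _) wP q1 qu.
have w4 : P / 4 <= l * `|w|.
  move: wP; rewrite ler_norml => /andP[+ _]; rewrite -(ler_pM2l l0).
  have -> : l * (`|w| - P / (2 * l)) = l * `|w| - P / 2 by field; lra.
  lra.
have wv0 : w + v != 0.
  rewrite -normr_gt0; have := lerB_normD w v.
  have : l * `|v| < l * rho by rewrite ltr_pM2l.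
  move=> lv wv; rewrite -(ltr_pM2l l0) mulr0.
  have : l * (`|w| - `|v|) <= l * `|w + v| by rewrite ler_pM2l.
  lra.
have qn : dual_norm q = 1 by exact: dual_norm_norming qu.
have qc : continuous q by apply: (@lin_cont _ 1) => u; rewrite mul1r.
have sum2 u : `|(phi \+ q) u| <= 2 * `|u|.
  by apply: le_trans (ler_normD _ _) _; have := phi1 u; have := q1 u; lra.
have sub2 u : `|(phi \- q) u| <= 2 * `|u|.
  by apply: le_trans (ler_normB _ _) _; have := phi1 u; have := q1 u; lra.
have w_gt0 : 0 < `|w| by rewrite -(ltr_pM2l l0) mulr0; lra.
(* [phi] and [q] both almost norm [w], the latter because it norms w + v. Their sum is then too long
   for [lucE] unless they are close, and closeness replaces P q v by p v in [bound]. *)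
have big : 1 - del < dual_norm (phi \+ q) / 2.
  have dn : phi w + q w <= dual_norm (phi \+ q) * `|w|.
    exact: le_trans (ler_norm _) (le_dual_norm w (linZ (phi \+ q)) sum2).
  have phiw : `|w| - rho / 8 <= phi w.
    rewrite phiE ler_pdivlMl//; have := quad_ge P `|w| l0.
    have : rho * (rho * l) <= rho * (P / 8) by rewrite ler_pM2l.
    rewrite expr2 in pw *; lra.
  have qw : `|w| - 2 * rho <= q w.
    have := le_trans (ler_norm _) (q1 v); have := lerB_normD w v.
    move: qu; rewrite raddfD/=; lra.
  rewrite ltNge; apply/negP => dn2.
  have : dual_norm (phi \+ q) * `|w| <= (2 - 2 * del) * `|w|.
    by rewrite ler_pM2r//; lra.
  have : del * (P / 4) <= del * (l * `|w|) by rewrite ler_pM2l.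
  have : del * P > 0 by rewrite mulr_gt0.
  move=> dP dw dn3; have : 2 * del * `|w| <= 17 / 8 * rho by lra.
  rewrite -(ler_pM2l l0); lra.
have small : dual_norm (phi \- q) < e / (2 * P).
  by rewrite ltNge; apply/negP => /(lucE q qc qn); rewrite leNgt big.
have : P * q v <= p v + e / 2 * `|v|.
  have : - (phi v - q v) <= e / (2 * P) * `|v|.
    apply: le_trans (ler_norm _) _; rewrite normrN.
    apply: le_trans (le_dual_norm v (linZ (phi \- q)) sub2) _.
    by rewrite ler_wpM2r// ltW.
  rewrite -(ler_pM2l Pp).
  have -> : P * (- (phi v - q v)) = P * q v - p v.
    by rewrite phiE; field.
  have -> : P * (e / (2 * P) * `|v|) = e / 2 * `|v| by field.
  lra.
have : 3 * l * rho * `|v| <= e / 2 * `|v| by rewrite ler_wpM2r//; lra.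
lra.
Qed.

End SmoothNorm.

(** * Infimal convolution with a multiple of the squared norm *)

Section InfConvolution.
Context {R : realType} {X : normedModType R}.
Implicit Types (U : set X) (f g : X -> R) (x y z v : X).

(* For a convex g with a continuous subgradient at x, this is Frechet
   differentiability at x. *)
Definition smooth_at g x := forall e : R, 0 < e -> exists2 d, 0 < d &
  forall v, `|v| < d -> g (x + v) + g (x - v) - 2 * g x <= e * `|v|.

Definition infconv U f l x := inf [set f y + l * `|x - y| ^+ 2 | y in U].

Context (U : set X) (f : X -> R) (l : R).
Hypotheses (l0 : 0 < l) (cU : cset U) (cf : cfun U f).
Context (x0 : X) (k0 : R).
Hypotheses (Ux0 : U x0) (fx0 : slope_le U f k0 x0) (k00 : 0 <= k0).

Local Notation h := (infconv U f l).
Local Notation E x := [set f y + l * `|x - y| ^+ 2 | y in U].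

(** A slope bound at the single point [x0] suffices for every x in X: [f] decreases at most linearly
    away from [x0], and the quadratic term wins. *)
Let hE x : has_inf (E x).
Proof.
split; first by exists (f x0 + l * `|x - x0| ^+ 2), x0.
exists (f x0 - k0 * `|x - x0| - k0 ^+ 2 / (4 * l)) => _ [y Uy <-].
have := quad_ge k0 `|x - y| l0; have := fx0 Uy.
have : k0 * `|x0 - y| <= k0 * (`|x - x0| + `|x - y|).
  apply: ler_wpM2l => //; rewrite [`|x - x0|]distrC.
  exact: ler_distD.
rewrite mulrDr; lra.
Qed.

Lemma infconv_le x y : U y -> h x <= f y + l * `|x - y| ^+ 2.
Proof. by move=> Uy; apply: ge_inf; [exact: (hE x).2 | exists y]. Qed.

Lemma infconv_near x e : 0 < e ->
  exists2 y, U y & f y + l * `|x - y| ^+ 2 <= h x + e.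
Proof.
move=> e0; have [_ [y Uy <-] /ltW hy] := inf_adherent e0 (hE x).
by exists y.
Qed.

Lemma le_infconv x r :
  (forall y, U y -> r <= f y + l * `|x - y| ^+ 2) -> r <= h x.
Proof.
move=> hr; apply: lb_le_inf; first exact: (hE x).1.
by move=> _ [y Uy <-]; exact: hr.
Qed.

Lemma infconv_le_id x : U x -> h x <= f x.
Proof.
by move=> /(infconv_le x); rewrite subrr normr0 expr0n/= mulr0 addr0.
Qed.

Lemma infconv_convex : cfun setT h.
Proof.
move=> t x y t0 t1 _ _; apply/ler_addgt0Pr => e e0.
have [a Ua ha] := infconv_near x e0; have [b Ub hb] := infconv_near y e0.
have := infconv_le (t *: x + (1 - t) *: y) (cU t0 t1 Ua Ub).
have := cf t0 t1 Ua Ub.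
have t1' : 0 <= 1 - t by lra.
have : l * `|t *: x + (1 - t) *: y - (t *: a + (1 - t) *: b)| ^+ 2 <=
    t * (l * `|x - a| ^+ 2) + (1 - t) * (l * `|y - b| ^+ 2).
  rewrite opprD addrACA -!scalerBr.
  have : `|t *: (x - a) + (1 - t) *: (y - b)| <= t * `|x - a| + (1 - t) * `|y - b|.
    by apply: le_trans (ler_normD _ _) _; rewrite !normrZ !ger0_norm.
  rewrite -(ler_pXn2r (ltn0Sn 1)) ?nnegrE ?addr_ge0 ?mulr_ge0//.
  rewrite -(ler_pM2l l0) => /le_trans; apply.
  have : 0 <= l * (t * (1 - t) * (`|x - a| - `|y - b|) ^+ 2).
    apply: mulr_ge0; first exact: ltW.
    by apply: mulr_ge0 (sqr_ge0 _); exact: mulr_ge0.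
  lra.
have : t * (f a + l * `|x - a| ^+ 2) <= t * (h x + e) by exact: ler_wpM2l.
have : (1 - t) * (f b + l * `|y - b| ^+ 2) <= (1 - t) * (h y + e).
  exact: ler_wpM2l.
rewrite !mulrDr; lra.
Qed.

Lemma infconv_ge x k : slope_le U f k x -> f x - k ^+ 2 / (4 * l) <= h x.
Proof.
move=> fk; apply: le_infconv => y Uy.
have := fk y Uy; have := quad_ge k `|x - y| l0; lra.
Qed.

(* Slide a near-minimizer y for z along [y, x] until it is as far from x as y is
   from z. *)
Lemma infconv_slope x k : U x -> 0 <= k -> slope_le U f k x ->
  slope_le setT h k x.
Proof.
move=> Ux k_ge0 fk z _; rewrite lerBlDr; apply/ler_addgt0Pr => e e0.
have [y Uy hy] := infconv_near z e0.
have [xy|xy] := leP `|x - y| `|z - y|.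
  have := infconv_le x Uy.
  have : l * `|x - y| ^+ 2 <= l * `|z - y| ^+ 2.
    by rewrite ler_pM2l// ler_sqr ?nnegrE.
  have : 0 <= k * `|x - z| by rewrite mulr_ge0.
  lra.
have xy0 : 0 < `|x - y| by rewrite (le_lt_trans _ xy).
pose t := `|z - y| / `|x - y|.
have t0 : 0 <= t by rewrite divr_ge0.
have t1 : t <= 1 by rewrite ler_pdivrMr// mul1r ltW.
have tE : t * `|x - y| = `|z - y| by rewrite divfK// gt_eqF.
have := infconv_le x (cU t0 t1 Uy Ux); have := cf t0 t1 Uy Ux.
have -> : x - (t *: y + (1 - t) *: x) = t *: (x - y).
  by rewrite scalerBl scale1r scalerBr opprD opprB addrCA [x + _]addrC subrK addrC.
rewrite normrZ ger0_norm// tE.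
have t1' : 0 <= 1 - t by lra.
have : (1 - t) * (f x - f y) <= (1 - t) * (k * `|x - y|).
  by apply: ler_wpM2l => //; exact: fk.
have -> : (1 - t) * (k * `|x - y|) = k * (`|x - y| - `|z - y|).
  by rewrite -tE; ring.
have : k * (`|x - y| - `|z - y|) <= k * `|x - z|.
  apply: ler_wpM2l => //; have := ler_distD z x y; lra.
lra.
Qed.

Lemma infconv_lb x m : (forall y, U y -> m <= f y) -> m <= h x.
Proof.
move=> mf; apply: le_infconv => y Uy.
apply: le_trans (mf y Uy) _; rewrite lerDl mulr_ge0 ?sqr_ge0// ltW//.
Qed.

(** Since f y >= m, a near-minimizer y must be close to x and have f y close to m; the slope bound
    at x carries this back to x. The radius r is such that l r^2 + k r <= e. *)
Lemma infconv_lb_eq x k m : U x -> 0 <= k -> slope_le U f k x ->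
  (forall y, U y -> m <= f y) -> h x = m -> f x = m.
Proof.
move=> Ux k_ge0 fk mf hm; apply/eqP; rewrite eq_le mf// andbT.
apply/ler_addgt0Pr => e e0.
pose r := Num.min 1 (e / (l + k)).
have lk : 0 < l + k by rewrite ltr_wpDr.
have r0 : 0 < r by rewrite lt_min ltr01 divr_gt0.
have r1 : r <= 1 by rewrite ge_min lexx.
have re : (l + k) * r <= e by rewrite mulrC -ler_pdivlMr// ge_min lexx orbT.
have [|y Uy] := @infconv_near x (l * r ^+ 2); first by rewrite mulr_gt0// exprn_gt0.
rewrite hm => hy; have my := mf y Uy.
have ly : 0 <= l * `|x - y| ^+ 2 by rewrite mulr_ge0 ?sqr_ge0// ltW.
have xyr : `|x - y| <= r.
  rewrite -ler_sqr ?nnegrE ?(ltW r0)//.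
  rewrite -(ler_pM2l l0); lra.
have : k * `|x - y| <= k * r by exact: ler_wpM2l.
have : l * r ^+ 2 <= l * r by rewrite ler_pM2l// expr2 ler_piMl// ltW.
have := fk y Uy; lra.
Qed.

(** For a near-minimizer y, f y + l |. - y|^2 lies above the infimal convolution and almost touches
    it at x. A subgradient p at x is therefore an approximate subgradient of l |.|^2 at x - y. *)
Lemma infconv_smooth x k : dual_locally_uniformly_convex X ->
  U x -> 0 <= k -> slope_le U f k x -> smooth_at h x.
Proof.
move=> luc Ux k_ge0 fk e e0.
have cT : cset [set: X] by [].
have [p [pk ph]] :=
  subgradient cT infconv_convex I k_ge0 (infconv_slope Ux k_ge0 fk).
have e2 : 0 < e / 2 by lra.
have [eta [eta0 [d d0 near_p]]] := sqr_norm_smooth luc pk l0 e2.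
have up v : `|v| < d -> h (x + v) <= h x + (p v + e / 2 * `|v|).
  move=> vd; apply/ler_addgt0Pr => s s0.
  (* [eta] and [d] were fixed before y, so the accuracy of y may depend on s, which then tends to
     0. *)
  pose r := Num.min s eta.
  have r0 : 0 < r by rewrite lt_min s0 eta0.
  have rs : r <= s by rewrite ge_min lexx.
  have reta : r <= eta by rewrite ge_min lexx orbT.
  have [y Uy hy] := infconv_near x r0.
  have := near_p (x - y) v _ vd.
  have := infconv_le (x + v) Uy; rewrite addrAC => h1 h2.
  suff : l * `|x - y + v| ^+ 2 - l * `|x - y| ^+ 2 <= p v + e / 2 * `|v| by lra.
  apply: h2 => w'; have := ph (w' + y) I; have := infconv_le (w' + y) Uy.
  rewrite addrK (_ : w' + y - x = w' - (x - y)); last by rewrite opprB addrA.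
  lra.
exists d => // v vd; have := up _ vd; have := up (- v).
by rewrite normrN raddfN => /(_ vd); lra.
Qed.

End InfConvolution.

(** * A C^1 maximum of two real numbers *)

Section SmoothMax.
Context {R : realType}.
Implicit Types (d s t : R).

Definition ramp d t : R := Num.max 0 (Num.min 1 ((t + d) / (2 * d))).

(* [pospart d] is the C^1 regularization of [Num.max 0], also equal to the
   maximum of [s t + d s (1 - s)] over s in [0, 1], attained at [ramp d t]. *)
Definition pospart d t := ramp d t * t + d * (ramp d t * (1 - ramp d t)).

Lemma ramp_itv d t : 0 <= ramp d t <= 1.
Proof. by rewrite /ramp le_max lexx ge_max ler01 ge_min lexx. Qed.

Lemma pospart_ge d t s : 0 < d -> 0 <= s -> s <= 1 ->
  s * t + d * (s * (1 - s)) <= pospart d t.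
Proof.
move=> d0 s0 s1; rewrite /pospart /ramp.
have d20 : 0 < 2 * d by rewrite mulr_gt0.
have sd : 0 <= d * (s * s) by rewrite !mulr_ge0// ltW.
have sd' : 0 <= d * ((1 - s) * (1 - s)).
  by apply: mulr_ge0; [exact: ltW | rewrite mulr_ge0//; lra].
case: (leP 1 ((t + d) / (2 * d))) => [|].
  rewrite ler_pdivlMr// mul1r => td.
  rewrite max_r ?ler01//.
  have : (1 - s) * (t - d) >= 0 by apply: mulr_ge0; lra.
  lra.
rewrite ltr_pdivrMr// mul1r => td.
case: (leP 0 ((t + d) / (2 * d))) => [|].
  rewrite ler_pdivlMr// mul0r => td'.
  rewrite -subr_ge0.
  set u := (t + d) / (2 * d).
  have tE : t = 2 * d * u - d by rewrite /u; field; lra.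
  have : 0 <= d * (u - s) ^+ 2 by rewrite mulr_ge0 ?sqr_ge0// ltW.
  rewrite tE; lra.
rewrite ltr_pdivrMr// mul0r => td'.
have : s * (- (t + d)) >= 0 by apply: mulr_ge0; lra.
lra.
Qed.

Lemma pospart_out d t : 0 < d -> t <= - d -> pospart d t = 0.
Proof.
move=> d0 td; rewrite /pospart (_ : ramp d t = 0) ?mul0r ?mulr0 ?addr0//.
apply: max_l; rewrite ge_min; apply/orP; right.
by rewrite ler_pdivrMr ?mulr_gt0// mul0r; lra.
Qed.

Lemma ramp_lip d s t : 0 < d -> s <= t -> ramp d t - ramp d s <= (t - s) / (2 * d).
Proof.
move=> d0 st; have d20 : 0 < 2 * d by rewrite mulr_gt0.
have : (s + d) / (2 * d) <= (t + d) / (2 * d) by rewrite ler_pM2r ?invr_gt0//; lra.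
have -> : (t - s) / (2 * d) = (t + d) / (2 * d) - (s + d) / (2 * d).
  by rewrite -mulrBl; congr (_ / _); lra.
rewrite /ramp; move: (_ / _) (_ / _) => a b ab.
case: (leP 1 a) => ?; case: (leP 1 b) => ?; rewrite ?(max_r ler01).
all: case: (leP 0 a) => ?; case: (leP 0 b) => ?; lra.
Qed.

(** [ramp d t] is the derivative of [pospart d] at t. The lower bound comes from the description as
    a maximum; the same description at s, with the Lipschitz constant 1 / 2d of the ramp, gives the
    upper bound. *)
Lemma pospart_support d t s : 0 < d ->
  ramp d t * (s - t) <= pospart d s - pospart d t <=
    ramp d t * (s - t) + (s - t) ^+ 2 / (2 * d).
Proof.
move=> d0; have /andP[rt0 rt1] := ramp_itv d t; have /andP[rs0 rs1] := ramp_itv d s.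
have ht := pospart_ge s d0 rt0 rt1; have hs := pospart_ge t d0 rs0 rs1.
have dE : (s - t) ^+ 2 / (2 * d) = ((s - t) / (2 * d)) * (s - t).
  by rewrite expr2 mulrAC.
apply/andP; split; first by rewrite {2}/pospart; lra.
have : (ramp d s - ramp d t) * (s - t) <= (s - t) ^+ 2 / (2 * d).
  rewrite dE; have [st|/ltW st] := leP t s.
    by apply: ler_wpM2r; [lra | exact: ramp_lip].
  rewrite -subr_ge0 -mulrBl -mulrNN; apply: mulr_ge0; last by lra.
  by have := ramp_lip d0 st; rewrite -(opprB s t) mulNr; lra.
rewrite {1}/pospart; lra.
Qed.

Definition smax d a b := a + pospart d (b - a).

(** (1 - t, t) is the gradient at (a, b). Being convex weights, it transfers convexity and slope
    bounds to smooth maxima, and the quadratic remainder transfers smoothness. *)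
Lemma smax_support d a b : 0 < d -> exists t, [/\ 0 <= t, t <= 1 &
  forall a' b',
    (1 - t) * (a' - a) + t * (b' - b) <= smax d a' b' - smax d a b <=
    (1 - t) * (a' - a) + t * (b' - b) +
        ((b' - a') - (b - a)) ^+ 2 / (2 * d)].
Proof.
move=> d0; exists (ramp d (b - a)); have /andP[r0 r1] := ramp_itv d (b - a).
split=> // a' b'; have := pospart_support (b - a) (b' - a') d0.
by rewrite /smax => /andP[h1 h2]; apply/andP; split; lra.
Qed.

Lemma smax_gel d a b : 0 < d -> a <= smax d a b.
Proof.
by move=> d0; have := @pospart_ge d (b - a) 0 d0 (lexx _) ler01; rewrite /smax; lra.
Qed.

Lemma smax_ger d a b : 0 < d -> b <= smax d a b.
Proof.
by move=> d0; have := @pospart_ge d (b - a) 1 d0 ler01 (lexx _); rewrite /smax; lra.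
Qed.

Lemma smax_idl d a b : 0 < d -> b <= a - d -> smax d a b = a.
Proof. by move=> d0 ab; rewrite /smax pospart_out ?addr0//; lra. Qed.

Lemma smax_le d a b a' b' : 0 < d -> a <= a' -> b <= b' ->
  smax d a b <= smax d a' b'.
Proof.
move=> d0 aa' bb'; have [t [t0 t1 /(_ a' b') /= /andP[+ _]]] := smax_support a b d0.
have : 0 <= (1 - t) * (a' - a) by apply: mulr_ge0; lra.
have : 0 <= t * (b' - b) by apply: mulr_ge0; lra.
lra.
Qed.

End SmoothMax.

(** * Properties of approximations that are stable under smooth maxima *)

Section Regular.
Context {R : realType} {X : normedModType R}.
Context (U : set X) (f : X -> R).
Implicit Types (a b g : X -> R) (x y z v : X).

Definition regular_approx g := [/\ cfun U g,
  forall x, U x -> smooth_at g x &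
  forall x k, U x -> 0 <= k -> slope_le U f k x -> slope_le U g k x].

(** Stated with arbitrary lower bounds m instead of the infimum, which need not be finite or
    attained. *)
Definition same_inf g := [/\ forall x, U x -> g x <= f x,
  forall m, (forall y, U y -> m <= f y) -> forall x, U x -> m <= g x &
  forall m, (forall y, U y -> m <= f y) -> forall x, U x -> g x = m -> f x = m].

Definition locally_slope_bounded := forall x, U x ->
  exists k r, [/\ 0 <= k, 0 < r &
    forall z, `|z - x| < r -> U z /\ slope_le U f k z].

Hypotheses (cU : cset U) (lsb : locally_slope_bounded).

Lemma regular_lip g x k r v : regular_approx g -> U x -> 0 <= k ->
  (forall z, `|z - x| < r -> U z /\ slope_le U f k z) -> `|v| < r ->
  `|g (x + v) - g x| <= k * `|v|.
Proof.
move=> [_ _ gs] Ux k0 kr vr.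
have r0 : 0 < r by exact: le_lt_trans vr.
have [Uxv fxv] : U (x + v) /\ slope_le U f k (x + v).
  by apply: kr; rewrite addrC addKr.
have [_ fx] : U x /\ slope_le U f k x by apply: kr; rewrite subrr normr0.
have := gs _ _ Uxv k0 fxv _ Ux; have := gs _ _ Ux k0 fx _ Uxv.
rewrite opprD addNKr normrN [x + v - x]addrC addKr ler_norml; lra.
Qed.

Lemma regularB g c : regular_approx g -> regular_approx (fun x => g x - c).
Proof.
move=> [cg sg lg]; split=> [t x y t0 t1 Ux Uy|x Ux e e0|x k Ux k0 fk z Uz].
- by have := cg t x y t0 t1 Ux Uy; lra.
- have [d d0 gd] := sg x Ux e e0; exists d => // v /gd; lra.
- by have := lg x k Ux k0 fk z Uz; lra.
Qed.

Lemma regular_smax a b d : 0 < d -> regular_approx a -> regular_approx b ->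
  regular_approx (fun x => smax d (a x) (b x)).
Proof.
move=> d0 ra rb; have [ca sa la] := ra; have [cb sb lb] := rb.
split=> [t x y t0 t1 Ux Uy|x Ux e e0|x k Ux k0 fk z Uz].
- set z := _ + _.
  have [s [s0 s1 sE]] := smax_support (a z) (b z) d0.
  have /andP[h1 _] := sE (a x) (b x); have /andP[h2 _] := sE (a y) (b y).
  have h3 : 0 <= (1 - s) * (t * a x + (1 - t) * a y - a z).
    by apply: mulr_ge0; rewrite subr_ge0//; exact: ca.
  have h4 : 0 <= s * (t * b x + (1 - t) * b y - b z).
    by apply: mulr_ge0; rewrite ?subr_ge0//; exact: cb.
  have := ler_wpM2l t0 h1.
  have t1' : 0 <= 1 - t by lra.
  have := ler_wpM2l t1' h2.
  lra.
- have [k [r [k0 r0 kr]]] := lsb Ux.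
  have e2 : 0 < e / 2 by lra.
  have [d1 d10 ad] := sa x Ux _ e2; have [d2 d20 bd] := sb x Ux _ e2.
  (* The quadratic remainders at v and - v add up to at most 4 k^2 / d |v|^2; the summand 1 keeps
     [c] positive when k = 0. *)
  pose c := 4 * k ^+ 2 / d + 1.
  have c0 : 0 < c by rewrite ltr_wpDl// divr_ge0 ?mulr_ge0 ?sqr_ge0// ltW.
  exists (Num.min (Num.min d1 d2) (Num.min r (e / (2 * c)))).
    by rewrite !lt_min d10 d20 r0 divr_gt0// mulr_gt0.
  move=> v; rewrite !lt_min => /andP[/andP[vd1 vd2] /andP[vr vc]].
  have [s [s0 s1 sE]] := smax_support (a x) (b x) d0.
  have /andP[_ h1] := sE (a (x + v)) (b (x + v)).
  have /andP[_ h2] := sE (a (x - v)) (b (x - v)).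
  have h3 := ad v vd1; have h4 := bd v vd2.
  have s1' : 0 <= 1 - s by lra.
  have h5 := ler_wpM2l s0 h4; have h6 := ler_wpM2l s1' h3.
  have sq w : `|w| < r ->
      (b (x + w) - a (x + w) - (b x - a x)) ^+ 2 / (2 * d) <=
        2 * k ^+ 2 / d * `|w| ^+ 2.
    move=> wr.
    have := regular_lip ra Ux k0 kr wr; have := regular_lip rb Ux k0 kr wr.
    move=> hb ha; rewrite ler_pdivrMr ?mulr_gt0//.
    have -> : 2 * k ^+ 2 / d * `|w| ^+ 2 * (2 * d) = (2 * (k * `|w|)) ^+ 2.
      by field; rewrite gt_eqF.
    rewrite -real_normK ?num_real// ler_sqr ?nnegrE ?mulr_ge0//.
    have -> : b (x + w) - a (x + w) - (b x - a x) =
      b (x + w) - b x - (a (x + w) - a x) by lra.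
    by apply: le_trans (ler_normB _ _) _; lra.
  have := sq v vr; have := sq (- v); rewrite normrN => /(_ vr) sq1 sq2.
  have : 4 * k ^+ 2 / d * `|v| ^+ 2 <= e / 2 * `|v|.
    have -> : 4 * k ^+ 2 / d * `|v| ^+ 2 = 4 * k ^+ 2 / d * `|v| * `|v| by ring.
    apply: ler_wpM2r => //.
    apply: le_trans (_ : c * `|v| <= _).
      by apply: ler_wpM2r => //; rewrite /c lerDl.
    rewrite mulrC -ler_pdivlMr//; apply: le_trans (ltW vc) _.
    by rewrite le_eqVlt; apply/orP; left; apply/eqP; field; rewrite gt_eqF.
  lra.
- have [s [s0 s1 sE]] := smax_support (a x) (b x) d0.
  have /andP[h1 _] := sE (a z) (b z).
  have := ler_wpM2l s0 (lb x k Ux k0 fk z Uz).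
  have s1' : 0 <= 1 - s by lra.
  have := ler_wpM2l s1' (la x k Ux k0 fk z Uz).
  lra.
Qed.

(** Lowering [b] by at least the smoothing width prevents overshoot: smax d (f x) (f x - c) is still
    f x, and [smax] is monotone. *)
Lemma same_inf_smax a b d c : 0 < d -> d <= c -> same_inf a ->
  (forall x, U x -> b x <= f x - c) ->
  same_inf (fun x => smax d (a x) (b x)).
Proof.
move=> d0 dc [af am aE] bf; split=> [x Ux|m mf x Ux|m mf x Ux].
- rewrite -[leRHS](@smax_idl _ d _ (f x - c))//; last by lra.
  by apply: smax_le => //; [exact: af | exact: bf].
- by apply: le_trans (smax_gel _ _ d0); exact: am.
- move=> abm; apply: aE => //; apply/eqP; rewrite eq_le am// andbT -abm.
  exact: smax_gel.
Qed.

End Regular.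

(** * Gluing infimal convolutions into a uniform approximation *)

Section Glue.
Context {R : realType} {X : normedModType R}.
Context (U : set X) (f : X -> R).
Hypotheses (luc : dual_locally_uniformly_convex X).
Hypotheses (cU : cset U) (cf : cfun U f) (lsb : locally_slope_bounded U f).
Context (x0 : X) (Ux0 : U x0).

Lemma regular_infconv l : 0 < l -> regular_approx U f (infconv U f l).
Proof.
move=> l0; have [k0 [r0 [k00 r00 /(_ x0)]]] := lsb Ux0.
rewrite subrr normr0 => /(_ r00)[_ fx0].
split=> [t x y t0 t1 _ _|x Ux|x k Ux k_ge0 fk z Uz].
- exact: (infconv_convex l0 cU cf Ux0 fx0 k00).
- have [k [r [k_ge0 r_gt0 /(_ x)]]] := lsb Ux.
  rewrite subrr normr0 => /(_ r_gt0)[_ fx].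
  exact: (infconv_smooth l0 cU cf Ux0 fx0 k00 luc Ux k_ge0 fx).
- exact: (infconv_slope l0 cU cf Ux0 fx0 k00 Ux k_ge0 fk).
Qed.

Lemma same_inf_infconv l : 0 < l -> same_inf U f (infconv U f l).
Proof.
move=> l0; have [k0 [r0 [k00 r00 /(_ x0)]]] := lsb Ux0.
rewrite subrr normr0 => /(_ r00)[_ fx0].
split=> [x Ux|m mf x Ux|m mf x Ux].
- exact: (infconv_le_id l0 Ux0 fx0 k00 Ux).
- exact: (infconv_lb l0 Ux0 fx0 k00 x mf).
- have [k [r [k_ge0 r_gt0 /(_ x)]]] := lsb Ux.
  rewrite subrr normr0 => /(_ r_gt0)[_ fx].
  exact: (infconv_lb_eq l0 Ux0 fx0 k00 Ux k_ge0 fx mf).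
Qed.

Context (eps : R) (eps0 : 0 < eps).

(** [shift] increases from 0 towards [eps]. Of each [gap], one half pays for the error n^2 / (4 lam
    n) of [piece n] where slopes are at most n, the other half is the width of the smooth maximum.
    The 1 in [lam] keeps [lam 0] positive. *)
Let shift n : R := eps - eps / n.+1%:R.
Let gap n : R := shift n.+1 - shift n.
Let lam n : R := (n%:R ^+ 2 + 1) / (2 * gap n).
Let piece n x : R := infconv U f (lam n) x - shift n.

Fixpoint glued n : X -> R :=
  if n is m.+1 then fun x => smax (gap m / 2) (glued m x) (piece n x)
  else infconv U f (lam 0).

Let gap_gt0 n : 0 < gap n.
Proof.
rewrite /gap /shift opprB addrC addrA subrK subr_gt0 ltr_pM2l//.
by rewrite ltf_pV2 ?posrE ?ltr0n// ltr_nat.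
Qed.

Let gap_half n : 0 < gap n / 2.
Proof. by rewrite divr_gt0. Qed.

Let shift_ge0 n : 0 <= shift n.
Proof.
by rewrite subr_ge0 ler_pdivrMr ?ltr0n// ler_peMr ?(ltW eps0)// ler1n.
Qed.

Let lam_gt0 n : 0 < lam n.
Proof. by rewrite divr_gt0 ?mulr_gt0// ltr_wpDl// sqr_ge0. Qed.

Let piece_le n x : U x -> piece n x <= f x - shift n.
Proof. by move=> Ux; rewrite lerD2r; case: (same_inf_infconv (lam_gt0 n)) => + _ _; apply. Qed.

Let piece_ge n x : slope_le U f n%:R x -> f x - shift n - gap n / 2 <= piece n x.
Proof.
move=> fx; have [k0 [r0 [k00 r00 /(_ x0)]]] := lsb Ux0.
rewrite subrr normr0 => /(_ r00)[_ fx0].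
have := infconv_ge (lam_gt0 n) Ux0 fx0 k00 fx.
suff : n%:R ^+ 2 / (4 * lam n) <= gap n / 2 by rewrite /piece; lra.
have n1 : 0 < n%:R ^+ 2 + 1 :> R by rewrite ltr_wpDl// sqr_ge0.
rewrite ler_pdivrMr ?(mulr_gt0 _ (lam_gt0 n))//.
have -> : gap n / 2 * (4 * lam n) = n%:R ^+ 2 + 1.
  by rewrite /lam; field; rewrite gt_eqF.
by rewrite lerDl.
Qed.

Lemma regular_glued n : regular_approx U f (glued n).
Proof.
elim: n => [|n IHn] /=; first exact: regular_infconv.
by apply: regular_smax => //; apply: regularB; exact: regular_infconv.
Qed.

Lemma same_inf_glued n : same_inf U f (glued n).
Proof.
elim: n => [|n IHn] /=; first exact: same_inf_infconv.
apply: (@same_inf_smax _ _ _ _ _ _ _ (shift n.+1)) => //; last exact: piece_le.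
by have := shift_ge0 n; have := gap_gt0 n; rewrite /gap; lra.
Qed.

Let piece_le_glued n x : piece n x <= glued n x.
Proof.
case: n => [|n]; last exact: smax_ger.
by rewrite /piece /shift divr1 subrr subr0.
Qed.

Lemma slope_le_nat m n x : (m <= n)%N ->
  slope_le U f m%:R x -> slope_le U f n%:R x.
Proof.
move=> mn fm z Uz; apply: le_trans (fm z Uz) _.
by rewrite ler_wpM2r// ler_nat.
Qed.

(** For n >= m, [piece n] at x is at least f x - shift n - gap n / 2, whereas the next piece is at
    most f x - shift n - gap n. The difference is the full smoothing width, so the smooth maximum
    returns its first argument. *)
Lemma glued_stationary m n x : (m <= n)%N -> U x -> slope_le U f m%:R x ->
  glued n x = glued m x.
Proof.
move=> + Ux fm; elim: n => [|n IHn]; first by rewrite leqn0 => /eqP ->.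
rewrite leq_eqVlt => /orP[/eqP -> //|mn].
rewrite -IHn//=; apply: smax_idl => //.
have := piece_ge (slope_le_nat (m := m) (n := n) mn fm); have := piece_le n.+1 Ux.
have := piece_le_glued n x.
have : shift n.+1 = shift n + gap n by rewrite /gap; lra.
lra.
Qed.

(** Any index with a slope bound at x will do, by stationarity, and every x in U has one; the
    default 0 concerns points outside U only. *)
Let glue x := glued (xget 0%N [set n | slope_le U f n%:R x]) x.

Let glueE n x : U x -> slope_le U f n%:R x -> glue x = glued n x.
Proof.
move=> Ux fn; rewrite /glue; case: xgetP => [m _ /= fm|/(_ n)/(_ fn)//].
by have [mn|/ltnW nm] := leqP m n; [rewrite (glued_stationary mn) |
  rewrite (glued_stationary nm)].
Qed.

Let slope_nat x : U x -> exists n r, 0 < r /\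
  forall z, `|z - x| < r -> U z /\ slope_le U f n%:R z.
Proof.
move=> /lsb[k [r [k0 r0 kr]]]; exists (Num.bound k), r; split=> // z /kr[Uz fz].
split=> // y Uy; apply: le_trans (fz y Uy) _; apply: ler_wpM2r => //.
exact/ltW/archi_boundP.
Qed.

Let slope_nat1 x : U x -> exists n, slope_le U f n%:R x.
Proof.
move=> /slope_nat[n [r [r0 /(_ x)]]]; rewrite subrr normr0 => /(_ r0)[_ fx].
by exists n.
Qed.

Let glueE2 x y : U x -> U y -> exists N, forall n, (N <= n)%N ->
  glue x = glued n x /\ glue y = glued n y.
Proof.
move=> Ux Uy; have [m fx] := slope_nat1 Ux; have [n fy] := slope_nat1 Uy.
exists (maxn m n) => k; rewrite geq_max => /andP[mk nk].
by split; apply: glueE => //; [exact: slope_le_nat fx | exact: slope_le_nat fy].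
Qed.

Lemma uniform_approx : exists g, [/\ regular_approx U f g, same_inf U f g &
  forall x, U x -> f x - eps <= g x].
Proof.
exists glue; split.
- split=> [t x y t0 t1 Ux Uy|x Ux e e0|x k Ux k0 fk z Uz].
  + have [N xyE] := glueE2 Ux Uy; have Uz := cU t0 t1 Ux Uy.
    have [n fz] := slope_nat1 Uz.
    have [-> ->] := xyE (maxn N n) (leq_maxl _ _).
    rewrite (glueE Uz (slope_le_nat (leq_maxr N n) fz)).
    by have [+ _ _] := regular_glued (maxn N n); apply.
  + have [n [r [r0 nr]]] := slope_nat Ux.
    have [_ /(_ x Ux e e0)[d d0 gd] _] := regular_glued n.
    exists (Num.min d r); first by rewrite lt_min d0.
    move=> v; rewrite lt_min => /andP[vd vr].
    have near w : `|w| < r -> glue (x + w) = glued n (x + w).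
      move=> wr; have [|Uw fw] := nr (x + w); first by rewrite addrC addKr.
      exact: glueE.
    rewrite !near ?normrN// -[X in glue X]addr0 near ?normr0// addr0.
    exact: gd.
  + have [N xzE] := glueE2 Ux Uz; have [-> ->] := xzE N (leqnn _).
    by have [_ _] := regular_glued N; apply.
- split=> [x Ux|m mf x Ux|m mf x Ux]; have [n fx] := slope_nat1 Ux;
    rewrite (glueE Ux fx); have [h1 h2 h3] := same_inf_glued n.
  + exact: h1.
  + exact: h2.
  + exact: h3.
- move=> x Ux; have [n fx] := slope_nat1 Ux; rewrite (glueE Ux fx).
  have := piece_ge fx; have := piece_le_glued n x; have := gap_gt0 n.
  have : shift n.+1 <= eps by rewrite gerBl divr_ge0// ltW.
  have : shift n.+1 = shift n + gap n by rewrite /gap; lra.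
  lra.
Qed.

End Glue.

(** * Averages of bounded sequences with weights 2^-(k+1) *)

Section Average.
Context {R : realType}.
Implicit Types (u v : R^nat) (c C e : R).

Definition avg u : R := limn (series (fun k => 2^-1 ^+ k.+1 * u k)).

Definition bounded_seq u := exists C, forall k, `|u k| <= C.

Let half_gt0 k : 0 < 2^-1 ^+ k.+1 :> R.
Proof. by rewrite exprn_gt0// invr_gt0. Qed.

Lemma avg_cvg u : bounded_seq u -> cvgn (series (fun k => 2^-1 ^+ k.+1 * u k)).
Proof.
move=> [C uC]; apply: normed_cvg.
apply: (@series_le_cvg _ _ (geometric (C * 2^-1) 2^-1)) => [n|n|n|].
- exact: normr_ge0.
- by rewrite mulr_ge0 ?exprn_ge0 ?invr_ge0// mulr_ge0 ?invr_ge0// (le_trans _ (uC 0)).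
- rewrite /= normrM gtr0_norm// -mulrA -exprS mulrC.
  by rewrite ler_wpM2r// ltW.
- apply: is_cvg_geometric_series.
  by rewrite gtr0_norm ?invr_gt0// invf_lt1// ltr1n.
Qed.

Lemma bounded_seqD u v : bounded_seq u -> bounded_seq v ->
  bounded_seq (fun k => u k + v k).
Proof.
move=> [C uC] [D vD]; exists (C + D) => k.
by apply: le_trans (ler_normD _ _) _; exact: lerD.
Qed.

Lemma bounded_seqZ u c : bounded_seq u -> bounded_seq (fun k => c * u k).
Proof.
by move=> [C uC]; exists (`|c| * C) => k; rewrite normrM ler_wpM2l.
Qed.

Lemma avgD u v : bounded_seq u -> bounded_seq v ->
  avg (fun k => u k + v k) = avg u + avg v.
Proof.
move=> /avg_cvg bu /avg_cvg bv; rewrite /avg -lim_seriesD//.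
by congr (limn (series _)); apply/funext => k; rewrite fctE mulrDr.
Qed.

Lemma avgZ u c : bounded_seq u -> avg (fun k => c * u k) = c * avg u.
Proof.
move=> /avg_cvg bu; rewrite /avg -[RHS]/(c *: (_ : R^o)) -lim_seriesZ//.
by congr (limn (series _)); apply/funext => k; exact: mulrCA.
Qed.

Lemma avg_cst c : avg (fun=> c) = c.
Proof.
apply/cvg_lim => //.
rewrite (_ : (fun k => _) = geometric (c * 2^-1) 2^-1); last first.
  by apply/funext => k; rewrite /= exprS mulrC mulrA.
have h : `|2^-1 : R| < 1 by rewrite gtr0_norm ?invr_gt0// invf_lt1// ltr1n.
have := @cvg_geometric_series R (c * 2^-1) _ h.
by rewrite (_ : c * 2^-1 * _ = c)//; field.
Qed.

Lemma avg_le u v : bounded_seq u -> bounded_seq v -> (forall k, u k <= v k) ->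
  avg u <= avg v.
Proof.
move=> /avg_cvg bu /avg_cvg bv uv; apply: lim_series_le => // k.
by rewrite ler_wpM2l// ltW.
Qed.

Lemma avg_lt u v k : bounded_seq u -> bounded_seq v -> (forall k, u k <= v k) ->
  u k < v k -> avg u < avg v.
Proof.
move=> bu bv uv uvk; pose w i := v i + - 1 * u i.
have bw : bounded_seq w by apply: bounded_seqD => //; exact: bounded_seqZ.
have w0 i : 0 <= w i by rewrite /w mulN1r subr_ge0.
suff : 0 < avg w by rewrite avgD ?avgZ//; [lra | exact: bounded_seqZ].
apply: (@lt_le_trans _ _ (2^-1 ^+ k.+1 * w k)).
  by rewrite mulr_gt0// /w mulN1r subr_gt0.
apply: limr_ge; first exact: avg_cvg.
near=> n; have kn : (k < n)%N by near: n; exact: nbhs_infty_gt.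
rewrite seriesEord/= (bigD1 (Ordinal kn))//= lerDl.
by apply: sumr_ge0 => i _; rewrite mulr_ge0// ltW.
Unshelve. all: by end_near. Qed.

(** For smoothness of an average: the radius of smoothness may shrink with the index, so the fine
    bound [e] is available for finitely many terms only. The others have total weight 2^-N and need
    just a crude bound. *)
Lemma avg_trunc u e C N : 0 <= e -> 0 <= C -> bounded_seq u ->
  (forall k, (k < N)%N -> u k <= e) -> (forall k, u k <= C) ->
  avg u <= e + C * 2^-1 ^+ N.
Proof.
move=> e0 C0 bu ue uC.
pose s := series (fun k => 2^-1 ^+ k.+1 * u k).
have lo n : (n <= N)%N -> s n <= e * (1 - 2^-1 ^+ n).
  elim: n => [_|n IHn nN]; first by rewrite /s seriesEord /= big_ord0 expr0 subrr mulr0.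
  rewrite /s seriesSr; have := IHn (ltnW nN).
  have := ler_wpM2l (ltW (half_gt0 n)) (ue n nN).
  rewrite !exprS /s => h1 h2; apply: le_trans (lerD h2 h1) _; lra.
have hi n : s (N + n)%N <= e + C * (2^-1 ^+ N - 2^-1 ^+ (N + n)%N).
  elim: n => [|n IHn].
    rewrite addn0 subrr mulr0 addr0; apply: le_trans (lo N (leqnn _)) _.
    by rewrite ler_piMr// gerBl exprn_ge0// invr_ge0.
  rewrite addnS /s seriesSr; have := ler_wpM2l (ltW (half_gt0 (N + n))) (uC (N + n)%N).
  by rewrite exprS => h1; apply: le_trans (lerD IHn h1) _; lra.
apply: limr_le; first exact: avg_cvg.
near=> n; have Nn : (N <= n)%N by near: n; exact: nbhs_infty_ge.
rewrite -(subnKC Nn); apply: le_trans (hi _) _.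
by rewrite lerD2l ler_wpM2l// gerBl exprn_ge0// invr_ge0.
Unshelve. all: by end_near. Qed.

End Average.

(** * Approximation that preserves strict convexity *)

Section StrictApprox.
Context {R : realType} {X : normedModType R}.
Context (U : set X) (f : X -> R).
Hypotheses (luc : dual_locally_uniformly_convex X).
Hypotheses (cU : cset U) (cf : cfun U f) (lsb : locally_slope_bounded U f).

Definition scfun (h : X -> R) := forall t x y, 0 < t -> t < 1 -> U x -> U y ->
  x != y -> h (t *: x + (1 - t) *: y) < t * h x + (1 - t) * h y.

(* Infimal convolutions need not be strictly convex when their infima are not
   attained; an average of approximations converging to f is, because at any two
   points one of them is closer to f than the convexity gap of f there. *)
Lemma strict_approx eps : 0 < eps -> U !=set0 ->
  exists g, [/\ regular_approx U f g, same_inf U f g,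
    forall x, U x -> f x - eps <= g x & scfun f -> scfun g].
Proof.
move=> eps0 [x0 Ux0].
have epsk k : 0 < eps / k.+1%:R by rewrite divr_gt0// ltr0n.
have /choice[G GP] : forall k, exists g, [/\ regular_approx U f g,
    same_inf U f g & forall x, U x -> f x - eps / k.+1%:R <= g x].
  by move=> k; exact: (uniform_approx luc cU cf lsb Ux0).
have Gf k x : U x -> G k x <= f x by move=> Ux; have [_ [fE _ _] _] := GP k; exact: fE.
have fG k x : U x -> f x - eps / k.+1%:R <= G k x.
  by move=> Ux; have [_ _] := GP k; apply.
have fG1 k x : U x -> f x - eps <= G k x.
  move=> Ux; apply: le_trans (fG k x Ux); rewrite lerD2l lerN2.
  by rewrite ler_pdivrMr// ler_peMr ?(ltW eps0)// ler1n.
have bG x : U x -> bounded_seq (fun k => G k x).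
  move=> Ux; exists (`|f x| + eps) => k; have := Gf k x Ux; have := fG1 k x Ux.
  have := ler_norm (f x); have := ler_norm (- f x); rewrite normrN.
  by rewrite ler_norml => *; lra.
have bc c : bounded_seq (fun=> c : R) by exists `|c|.
pose g x := avg (fun k => G k x).
have bconv t x y : U x -> U y ->
    bounded_seq (fun k => t * G k x + (1 - t) * G k y).
  by move=> Ux Uy; apply: bounded_seqD; apply: bounded_seqZ; exact: bG.
have gconv t x y : U x -> U y ->
    avg (fun k => t * G k x + (1 - t) * G k y) = t * g x + (1 - t) * g y.
  move=> Ux Uy; rewrite avgD ?avgZ//.
  - exact: bG.
  - exact: bG.
  - exact/bounded_seqZ/bG.
  - exact/bounded_seqZ/bG.
exists g; split.
- split=> [t x y t0 t1 Ux Uy|x Ux e e0|x k Ux k0 fk z Uz].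
  + rewrite -gconv//; apply: avg_le; [exact/bG/cU|exact: bconv|] => k.
    by have [[+ _ _] _ _] := GP k; apply.
  + have [k [r [k0 r0 kr]]] := lsb Ux.
    have e2 : 0 < e / 2 by lra.
    (* All the approximations have the same Lipschitz bound k near x, so each second difference is
       at most 2 k |v| and the tail beyond N contributes at most e / 2 |v|. *)
    have [N NP] : exists N, 2 * k * 2^-1 ^+ N <= e / 2.
      have [N _ /(_ N (leqnn _))] : \forall N \near \oo, 2^-1 ^+ N < e / 2 / (2 * k + 1) :> R.
        have k1 : 0 < e / 2 / (2 * k + 1) by rewrite divr_gt0// ltr_wpDl// mulr_ge0.
        have h : `|2^-1 : R| < 1 by rewrite gtr0_norm ?invr_gt0// invf_lt1// ltr1n.
        have /cvgr0Pnorm_lt/(_ _ k1) := cvg_expr h.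
        by apply: filterS => n; rewrite normrX gtr0_norm ?invr_gt0.
      rewrite ltr_pdivlMr ?ltr_wpDl ?mulr_ge0// => h; exists N.
      apply: le_trans (ltW h); rewrite mulrC ler_wpM2l ?exprn_ge0 ?invr_ge0//.
      by rewrite lerDl.
    have [d [d0 dP]] : exists d, 0 < d /\ forall i, (i < N)%N -> forall v,
        `|v| < d -> G i (x + v) + G i (x - v) - 2 * G i x <= e / 2 * `|v|.
      elim: N {NP} => [|n [d [d0 dP]]]; first by exists 1.
      have [[_ /(_ x Ux _ e2)[d' d'0 d'P] _] _ _] := GP n.
      exists (Num.min d d'); split; first by rewrite lt_min d0.
      move=> i; rewrite ltnS leq_eqVlt => /orP[/eqP ->|ni] v; rewrite lt_min.
        by move=> /andP[_]; exact: d'P.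
      by move=> /andP[vd _]; exact: dP.
    exists (Num.min d r); first by rewrite lt_min d0.
    move=> v; rewrite lt_min => /andP[vd vr].
    have Uxv w : `|w| < r -> U (x + w).
      by move=> wr; have [] := kr (x + w); rewrite // addrC addKr.
    have Gk i w : `|w| < r -> G i (x + w) - G i x <= k * `|w|.
      move=> wr; have [ra _ _] := GP i.
      exact: le_trans (ler_norm _) (regular_lip ra Ux k0 kr wr).
    have vr' : `|- v| < r by rewrite normrN.
    have b1 := bG _ (Uxv _ vr); have b2 := bG _ (Uxv _ vr'); have b0 := bG _ Ux.
    have b12 := bounded_seqD b1 b2; have b3 := bounded_seqZ (- 2) b0.
    have b123 := bounded_seqD b12 b3.
    have -> : g (x + v) + g (x - v) - 2 * g x =
        avg (fun i => G i (x + v) + G i (x - v) + (- 2) * G i x).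
      by rewrite avgD// avgZ// avgD// mulNr.
    have := @avg_trunc _ _ (e / 2 * `|v|) (2 * k * `|v|) N _ _ b123.
    have -> : e / 2 * `|v| + 2 * k * `|v| * 2^-1 ^+ N =
      (e / 2 + 2 * k * 2^-1 ^+ N) * `|v| by ring.
    move=> h; apply: le_trans (_ : (e / 2 + 2 * k * 2^-1 ^+ N) * `|v| <= _).
      apply: h => [||i iN|i].
      - by rewrite mulr_ge0// ltW.
      - by rewrite !mulr_ge0.
      - by have := dP i iN v vd; lra.
      - by have := Gk i _ vr; have := Gk i _ vr'; rewrite normrN; lra.
    by rewrite ler_wpM2r//; lra.
  + have bz := bG _ Uz.
    have -> : g x - g z <= k * `|x - z| = (g x <= g z + k * `|x - z|).
      by rewrite lerBlDl.
    rewrite -(avg_cst (k * `|x - z|)) /g -avgD//.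
    apply: avg_le => [||i]; [exact: bG|exact: bounded_seqD|].
    have [[_ _ lG] _ _] := GP i; have := lG x k Ux k0 fk z Uz; lra.
- have glb m : (forall y, U y -> m <= f y) -> forall k x, U x -> m <= G k x.
    by move=> mf k x Ux; have [_ [_ fE _] _] := GP k; exact: fE.
  split=> [x Ux|m mf x Ux|m mf x Ux gm].
  + by rewrite -[leRHS]avg_cst; apply: avg_le => [||k]; [exact: bG|exact: bc|exact: Gf].
  + by rewrite -[leLHS]avg_cst; apply: avg_le => [||k]; [exact: bc|exact: bG|exact: glb].
  + have [_ [_ _ fE] _] := GP 0; apply: (fE m mf x Ux); apply/eqP.
    rewrite eq_le glb// andbT leNgt; apply/negP => mG.
    have : avg (fun=> m) < g x.
      apply: (avg_lt (k := 0)) => //; first exact: bG.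
      by move=> k; exact: glb.
    by rewrite avg_cst gm ltxx.
- move=> x Ux; rewrite -[leLHS]avg_cst; apply: avg_le => [||k].
  + exact: bc.
  + exact: bG.
  + exact: fG1.
- move=> sf t x y t0 t1 Ux Uy xy; have t0' := ltW t0; have t1' := ltW t1.
  have Uz := cU t0' t1' Ux Uy; rewrite -gconv//.
  set z := _ + _ in Uz *.
  pose del := t * f x + (1 - t) * f y - f z.
  have del0 : 0 < del by rewrite subr_gt0; exact: sf.
  have [k kP] : exists k : nat, eps / k.+1%:R < del.
    exists (Num.bound (eps / del)); rewrite ltr_pdivrMr// mulrC -ltr_pdivrMr//.
    apply: lt_le_trans (archi_boundP _) _; first by rewrite divr_ge0// ltW.
    by rewrite ler_nat.
  apply: (avg_lt (k := k)) => [|||]; [exact: bG|exact: bconv| |].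
    by move=> i; have [[+ _ _] _ _] := GP i; apply.
  apply: le_lt_trans (Gf k z Uz) _.
  have := ler_wpM2l t0' (fG k x Ux).
  have t1n : 0 <= 1 - t by lra.
  have := ler_wpM2l t1n (fG k y Uy).
  move: kP; rewrite /del; set q := eps / _; lra.
Qed.

End StrictApprox.

(** * From slope bounds to Lipschitz constants, minimizers and derivatives *)

Section Bridges.
Context {R : realType} {X : normedModType R}.
Implicit Types (U : set X) (f g : X -> R) (x y z v w : X).

Lemma cfunP U g : convex_function U g <-> cfun U g.
Proof.
split=> [cg t x y t0 t1 Ux Uy|cg t x y Ux Uy].
  have t01 : Itv.spec (Itv.num_sem (R := R)) (Itv.Real `[0%Z, 1%Z]) t.
    by rewrite /= /Itv.num_sem /= num_real in_itv /= t0.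
  have := cg (Itv.mk t01) x y; rewrite !inE => /(_ Ux Uy).
  by [].
rewrite !inE in Ux Uy.
exact: (cg t%:num x y).
Qed.

Lemma csetW U : convex_set U -> cset U.
Proof.
move=> cU t x y t0 t1 Ux Uy.
have t01 : Itv.spec (Itv.num_sem (R := R)) (Itv.Real `[0%Z, 1%Z]) t.
  by rewrite /= /Itv.num_sem /= num_real in_itv /= t0.
have := cU x y (Itv.mk t01); rewrite !inE => /(_ Ux Uy).
by [].
Qed.

Lemma scfunP U g : strictly_convex_function U g <-> scfun U g.
Proof.
split=> [cg t x y t0 t1 Ux Uy xy|cg t t0 t1 x y Ux Uy xy].
  have t01 : Itv.spec (Itv.num_sem (R := R)) (Itv.Real `[0%Z, 1%Z]) t.
    by rewrite /= /Itv.num_sem /= num_real in_itv /= !ltW.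
  have := cg (Itv.mk t01) t0 t1 x y; rewrite !inE => /(_ Ux Uy xy).
  by [].
rewrite !inE in Ux Uy.
exact: (cg t%:num x y).
Qed.

(** Prolong the segment from y to z by r to a point w. As z lies between y and w, convexity turns
    growth at rate at most k from z to w into decrease at rate at most k from z to y. *)
Lemma slope_of_growth U g k r z : cfun U g -> U z -> 0 < r ->
  (forall w, `|w - z| = r -> U w /\ g w - g z <= k * r) -> slope_le U g k z.
Proof.
move=> cg Uz r0 gr y Uy.
have [->|zy] := eqVneq z y; first by rewrite !subrr normr0 mulr0.
have D0 : 0 < `|z - y| by rewrite normr_gt0 subr_eq0.
set D := `|z - y| in D0 *.
pose w := z + (r / D) *: (z - y).
have [Uw gw] : U w /\ g w - g z <= k * r.
  apply: gr; rewrite /w addrAC subrr add0r normrZ gtr0_norm ?divr_gt0//.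
  by rewrite divfK// gt_eqF.
pose t := D / (D + r).
have Dr : 0 < D + r by rewrite addr_gt0.
have t0 : 0 <= t by rewrite divr_ge0// ltW.
have t1 : t <= 1 by rewrite ler_pdivrMr// mul1r lerDl ltW.
have := cg t w y t0 t1 Uw Uy.
have -> : t *: w + (1 - t) *: y = z.
  have -> : 1 - t = t * (r / D).
    by rewrite /t; field; rewrite ?gt_eqF.
  rewrite /w scalerDr -addrA scalerA -scalerDr subrK -scalerDl.
  rewrite (_ : t + t * (r / D) = 1) ?scale1r//.
  by rewrite /t; field; rewrite ?gt_eqF.
rewrite -(ler_pM2l Dr).
have -> : (D + r) * (t * g w + (1 - t) * g y) = D * g w + r * g y.
  by rewrite /t; field; rewrite gt_eqF.
have := ler_wpM2l (ltW D0) gw => h1 h2.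
rewrite -(ler_pM2l r0); lra.
Qed.

Lemma lsb_of_bounded U f : open U -> cfun U f ->
  (forall B : set X, B `<=` U -> bounded_set B ->
      (0 < set_dist B (frontier U))%E -> [bounded f x | x in B]) ->
  locally_slope_bounded U f.
Proof.
move=> oU cf bf x Ux.
have [r0 r0_gt0 rU] : exists2 r, 0 < r & forall z, `|z - x| < r -> U z.
  have /nbhs_ballP[r /= r0 rU] := open_nbhs_nbhs (conj oU Ux).
  by exists r => // z zx; apply: rU; rewrite -ball_normE /= distrC.
(* The ball [B] of radius 2r stays at distance at least 2r from the frontier, and it contains the
   spheres of radius r about all points within r of x. *)
pose r := r0 / 4; have r_gt0 : 0 < r by rewrite divr_gt0.
pose B := [set z | `|z - x| < 2 * r].
have BU : B `<=` U by move=> z; rewrite /B/= /r => zx; apply: rU; lra.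
have bB : bounded_set B.
  exists (`|x| + 2 * r); split=> [|M xM z Bz /=]; first exact: num_real.
  apply: le_trans (ltW xM); rewrite -lerBlDl.
  by apply: le_trans (lerB_dist _ _) _; exact: ltW.
have dB : (0 < set_dist B (frontier U))%E.
  apply: (@lt_le_trans _ _ (2 * r)%:E); first by rewrite lte_fin mulr_gt0.
  apply: le_ereal_inf_tmp => _ [a Ba <-]; apply: le_ereal_inf_tmp => _ [b Fb <-].
  apply: le_ereal_inf_tmp => _ [s [s0 +] <-]; rewrite -ball_normE /= => abs.
  rewrite lee_fin leNgt; apply/negP => sr; have [_ nUb] := Fb; apply: nUb.
  rewrite (_ : U° = U); last exact/interior_id.
  apply: rU; have : `|a - x| < 2 * r := Ba.
  have := ler_distD a b x; rewrite [`|b - a|]distrC /r in sr *; lra.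
have [M [_ /(_ (M + 1))]] := bf B BU bB dB.
rewrite ltrDl ltr01 => /(_ isT) fM.
have {}fM z : B z -> `|f z| <= M + 1 by exact: fM.
have M0 : 0 <= M + 1.
  by apply: le_trans (fM x _) => //=; rewrite /B/= subrr normr0 mulr_gt0.
exists (2 * (M + 1) / r), r; split=> //.
  by rewrite divr_ge0 ?mulr_ge0// ltW.
move=> z zx; have Bz : B z by rewrite /B/= (lt_trans zx)// ltr_pMl// ltr1n.
split; first exact: BU.
apply: (slope_of_growth cf (BU _ Bz) r_gt0) => w wz; have Bw : B w.
  have := ler_distD z w x; have : `|z - x| < r := zx; rewrite /B/= wz; lra.
split; first exact: BU.
rewrite divfK ?gt_eqF//; have := fM w Bw; have := fM z Bz.
rewrite !ler_norml; lra.
Qed.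

Lemma same_inf_minimizers U f g : same_inf U f g -> minimizers U g = minimizers U f.
Proof.
move=> [gf lbg eqg]; apply/seteqP; split=> x [Ux xmin]; split=> // y Uy.
  have lb z : U z -> g x <= f z by move=> Uz; apply: le_trans (gf z Uz); exact: xmin.
  by rewrite (eqg _ lb)//; exact: lb.
exact: le_trans (gf x Ux) (lbg _ xmin y Uy).
Qed.

(** A Lipschitz constant of [f] around an interior point a of [B'] bounds the growth on a small
    sphere about a, hence the slope of [f] from a to all of U. [g] inherits that slope at every
    point of [B], and two points of [B] then give both signs. *)
Lemma le_Lip U f g (B B' : set X) : cfun U f -> regular_approx U f g ->
  B `<=` U -> (forall a, B a -> \forall z \near a, B' z /\ U z) ->
  (Lip B g <= Lip (B' `&` U) f)%E.
Proof.
move=> cf [_ _ gs] BU BB'; apply: le_ereal_inf_tmp => _ [k [k0 fk] <-].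
apply: ereal_inf_lbound; exists k => //; split=> //.
have slope a b : B a -> B b -> g a - g b <= k * `|a - b|.
  move=> Ba Bb; apply: (gs a k (BU _ Ba) k0 _ b (BU _ Bb)).
  have /nbhs_ballP[r /= r0 rB] := BB' a Ba.
  have r2 : 0 < r / 2 by rewrite divr_gt0.
  have [B'a Ua] := rB a (ballxx _ r0).
  apply: (slope_of_growth cf (BU _ Ba) r2) => w wa.
  have [B'w Uw] : B' w /\ U w.
    by apply: rB; rewrite -ball_normE /= distrC wa; lra.
  split=> //; have := fk (w, a) (conj (conj B'w Uw) (conj B'a Ua)).
  by rewrite /= wa => /(le_trans (ler_norm _)).
move=> [a b] [/= Ba Bb]; rewrite ler_norml lerNl opprB.
by rewrite slope// andbT distrC slope.
Qed.

Lemma regular_local_Lip eps U f g : open U -> 0 < eps -> cfun U f ->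
  regular_approx U f g -> preserves_local_Lip eps U f g.
Proof.
move=> oU eps0 cf rg x r r0.
have er : r < (1 + eps) * r by rewrite ltr_pMl// ltrDl.
split=> BU; apply: (le_Lip cf rg BU) => a Ba.
- have Ua : nbhs a U by apply: open_nbhs_nbhs; split=> //; exact: BU.
  have Ba' : nbhs a (ball x ((1 + eps) * r)).
    apply: open_nbhs_nbhs; split; first exact: ball_open.
    exact: le_ball (ltW er) _ Ba.
  by apply: filterS2 Ba' Ua => z.
- have Ua : nbhs a U by apply: open_nbhs_nbhs; split=> //; exact: BU.
  have Ba' : nbhs a (ball x ((1 + eps) * r)).
    apply: open_nbhs_nbhs; split; first exact: ball_open.
    move: Ba; rewrite closed_ballE// -ball_normE /closed_ball_ /=.
    by move=> /le_lt_trans; apply.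
  apply: filterS2 Ba' Ua => z Bz Uz; split=> //; exact: subset_closed_ball Bz.
Qed.

Lemma has_diff g x (p : {linear X -> R^o}) k : (forall v, `|p v| <= k * `|v|) ->
  (forall e, 0 < e -> exists2 d, 0 < d &
    forall v, `|v| < d -> `|g (x + v) - g x - p v| <= e * `|v|) ->
  differentiable g x /\ ('d g x : X -> R) = p.
Proof.
move=> pk gp; have pc := lin_cont pk.
have E : (g : X -> R^o) \o shift x = cst (g x) + p +o_ 0 id.
  apply/eqaddoP => e e0; have [d d0 dP] := gp e e0.
  near=> v; rewrite /= !fctE /=.
  have vd : `|v| < d by near: v; exact: nbhs0_lt.
  by have := dP v vd; rewrite [v + x]addrC opprD addrA.
have dE := diff_unique pc E.
by split=> //; apply/diff_locallyP; rewrite dE.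
Unshelve. all: by end_near. Qed.

(** A subgradient makes the first-order remainder nonnegative, so a bound on its sum over v and - v
    bounds each term. Continuity of the derivative is automatic for convex functions. *)
Lemma regular_C1 U f g : open U -> cset U -> locally_slope_bounded U f ->
  regular_approx U f g -> C1_on U g.
Proof.
move=> oU cU lsb rg; have [cg sg lg] := rg.
have sub x k : U x -> 0 <= k -> slope_le U f k x ->
  exists p : {linear X -> R^o}, [/\ forall z, U z -> g x + p (z - x) <= g z,
    differentiable g x & ('d g x : X -> R) = p].
  move=> Ux k0 fx; have [p [pk ps]] := subgradient cU cg Ux k0 (lg x k Ux k0 fx).
  have [|dg dE] := has_diff (g := g) (x := x) pk; last by exists p.
  move=> e e0; have [d d0 dP] := sg x Ux e e0.
  have [k' [r [_ r0 rU]]] := lsb x Ux.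
  exists (Num.min d r); first by rewrite lt_min d0.
  move=> v; rewrite lt_min => /andP[vd vr].
  have pos w : `|w| < r -> p w <= g (x + w) - g x.
    move=> wr; have [|Uw _] := rU (x + w); first by rewrite addrC addKr.
    have := ps _ Uw; rewrite [x + w - x]addrC addKr; lra.
  have := pos v vr; have := pos (- v); rewrite normrN raddfN => /(_ vr).
  have := dP v vd => h1 h2 h3; rewrite ger0_norm; lra.
split=> [x Ux|x Ux].
  have [k [r [k0 r0 /(_ x)]]] := lsb x Ux.
  rewrite subrr normr0 => /(_ r0)[_ fx].
  by have [p []] := sub x k Ux k0 fx.
have [k [r [k0 r0 rU]]] := lsb x Ux.
have near_x w : `|w| < r -> U (x + w) /\ slope_le U f k (x + w).
  by move=> wr; apply: rU; rewrite addrC addKr.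
have [|_ fx] := near_x 0; first by rewrite normr0.
rewrite addr0 in fx.
have [p [ps dg dE]] := sub x k Ux k0 fx.
apply/cvgrPdist_le => e e0.
have e4 : 0 < e / 4 by rewrite divr_gt0.
have [d d0 dP] : exists2 d, 0 < d & forall v, `|v| < d -> g (x + v) <= g x + p v + e / 4 * `|v|.
  have [d d0 dP] := sg x Ux _ e4.
  exists (Num.min d r); first by rewrite lt_min d0.
  move=> v; rewrite lt_min => /andP[vd vr].
  have [|Uw _] := near_x (- v); first by rewrite normrN.
  have := ps _ Uw; rewrite [x - v - x]addrC addKr raddfN; have := dP v vd; lra.
pose s := Num.min d r / 4.
have s0 : 0 < s by rewrite divr_gt0// lt_min d0.
have sd : 4 * s <= d by rewrite /s mulrC divfK// ge_min lexx.
have sr : 4 * s <= r by rewrite /s mulrC divfK// ge_min lexx orbT.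
near=> y.
have yx : `|y - x| < s.
  by near: y; apply/nbhs_ballP; exists s => //= y; rewrite -ball_normE /= distrC.
have [Uy fy] : U y /\ slope_le U f k y by apply: rU; lra.
have [q [qs _ qE]] := sub y k Uy k0 fy.
(* The value of [g] at y + s w is squeezed between the subgradient [q] at y and the first-order
   expansion at x. The error e / 4 times 2 s is at most e s, and dividing by the step s leaves at
   most e. *)
have qp w : `|w| <= 1 -> q w - p w <= e.
  move=> w1; have sw : `|s *: w| <= s by rewrite normrZ gtr0_norm// ler_piMr// ltW.
  have yxw : `|y - x + s *: w| <= 2 * s.
    by apply: le_trans (ler_normD _ _) _; lra.
  have [|Uyw _] := near_x (y - x + s *: w); first lra.
  have sd2 : 2 * s < d by lra.
  have pD : p (y - x + s *: w) = p (y - x) + s * p w by rewrite -linZ; exact: raddfD.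
  have yE : x + (y - x + s *: w) - y = s *: w.
    by rewrite addrA [x + _]addrC subrK addrAC subrr add0r.
  have h1 := dP (y - x + s *: w) (le_lt_trans yxw sd2).
  have h2 := ps _ Uy; have h3 := qs _ Uyw; rewrite yE linZ in h3.
  have h4 : e / 4 * `|y - x + s *: w| <= e / 4 * (2 * s) by rewrite ler_pM2l.
  have es : 0 < e * s by rewrite mulr_gt0.
  rewrite -(ler_pM2l s0); rewrite pD in h1; lra.
have dn0 : 0 <= dual_norm (q \- p) by exact: dual_norm_ge0.
rewrite sub0r normrN qE dE ger0_norm//.
apply: dual_norm_le => [|v v1]; first exact: (raddf0 (q \- p)).
rewrite ler_norml lerNl [X in (X <= _) && _](_ : _ = q (- v) - p (- v)); last first.
  by rewrite !raddfN /=; lra.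
by rewrite !qp// normrN.
Unshelve. all: by end_near. Qed.

End Bridges.

Unset Implicit Arguments.
Set Strict Implicit.
Set Printing Implicit Defensive.

Theorem corollary3 (R : realType) (X : completeNormedModType R)
    (hX : dual_locally_uniformly_convex X)
    (U : set X) (openU : open U) (convU : convex_set U)
    (f : X -> R) (convf : convex_function U f)
    (bndf : forall B : set X, B `<=` U -> bounded_set B ->
      (0 < set_dist B (frontier U))%E -> [bounded f x | x in B])
    (eps : R) (eps_gt0 : 0 < eps) :
  exists g : X -> R,
    [/\ C1_on U g, convex_function U g &
        forall x, U x -> f x - eps <= g x <= f x] /\
    [/\ minimizers U g = minimizers U f,
        preserves_local_Lip eps U f g &
        strictly_convex_function U f -> strictly_convex_function U g].
Proof.
have cU := csetW convU; have cf := (cfunP U f).1 convf.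
(* An empty U offers no point at which to anchor the infimal convolutions; there [f] itself
   serves. *)
have [[x0 Ux0]|U0] := pselect (U !=set0); last first.
  have nU x : ~ U x by move=> Ux; apply: U0; exists x.
  exists f; split; split=> //.
  - by split=> x /nU.
  - by move=> x /nU.
  - by move=> x r r0; split=> BU; case: (nU x); apply: BU;
      [exact: ballxx | exact: closed_ballxx].
have lsb := lsb_of_bounded openU cf bndf.
have [|g [rg ig fg sg]] := strict_approx hX cU cf lsb eps_gt0.
  by exists x0.
have [cg _ _] := rg; have [gf _ _] := ig.
exists g; split; split.
- exact: regular_C1 openU cU lsb rg.
- exact/cfunP.
- by move=> x Ux; rewrite fg// gf.
- exact: same_inf_minimizers ig.
- exact: regular_local_Lip.
- by move=> /scfunP sf; apply/scfunP; exact: sg.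
Qed.
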